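(* Let $\mathbb{G}$ be a Clifford semigroup, let $L$ be its set of idempotents, and let $\mathbb{G}=\coprod_{x\in L}G(x)$ be the associated decomposition of $\mathbb{G}$ as a strong semilattice of groups. Then $\mathcal{A}_{\mathbb{G}}$ is biflat if and only if both of the following conditions hold: (i) $L$ is uniformly locally finite, i.e. $\sup_{f\in L}|\{y\in L: y\preceq f\}|<\infty$; (ii) the (discrete) group $G(x)$ is amenable for each $x\in L$.
   Context: A Clifford semigroup is an inverse semigroup whose idempotents are central; equivalently, a strong semilattice of groups. Its set $L$ of idempotents is a semilattice (commutative semigroup of idempotents), partially ordered by $e\preceq f\iff ef=e$. For $x\in L$, $G(x)$ is the maximal subgroup of $\mathbb{G}$ with identity element $x$; $\mathbb{G}$ is the disjoint union of the $G(x)$ and $G(e)\cdot G(f)\subseteq G(ef)$ for $e,f\in L$. For a semigroup $T$, $\mathcal{A}_T$ denotes its $\ell^1$-convolution algebra: the Banach space $\ell^1(T)$ with canonical basis $(e_t)_{t\in T}$ and the bounded bilinear product determined by $e_se_t=e_{st}$. For a Banach algebra $A$, let $\pi:A\widehat{\otimes}A\to A$ be the bounded linear map with $\pi(a\otimes b)=ab$ ($\widehat\otimes$ is the projective tensor product), let $''$ denote second dual / second adjoint, and let $\kappa:A\to A''$ be the natural embedding. $A\widehat{\otimes}A$ is an $A$-bimodule via $a\cdot(b\otimes c)=ab\otimes c$, $(b\otimes c)\cdot a=b\otimes ca$, and $(A\widehat{\otimes}A)''$ is an $A$-bimodule canonically. $A$ is biflat if there is a bounded $A$-bimodule map $\sigma:A\to(A\widehat{\otimes}A)''$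 with $\pi''\sigma=\kappa$. *)

(* Defs.v *)
From HB Require Import structures.
From mathcomp Require Import all_boot all_order all_algebra finmap.
From mathcomp Require Import boolp classical_sets functions fsbigop cardinality.
From mathcomp Require Import reals ereal topology normedtype numfun esum.
From mathcomp Require Import complex lra.

Set Implicit Arguments.
Unset Strict Implicit.
Unset Printing Implicit Defensive.

Import Order.TTheory GRing.Theory Num.Theory.
Import numFieldNormedType.Exports.

Local Open Scope classical_set_scope.
Local Open Scope ring_scope.
Local Open Scope complex_scope.

(* R[i] as a bundled field: all scalar structures are then read off this one
   constant. *)
Definition Cx (R : realType) : numClosedFieldType := R[i].

(* The norm of a normedModType over R[i] takes its values in R[i]; rnorm is
   the same norm as an element of R. *)
Definition rnorm {R : realType} {V : normedModType (Cx R)} (x : V) : R :=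
  complex.Re `|x|.

Section RealNorm.
Context {R : realType} {V : normedModType (Cx R)}.
Implicit Types x y : V.

Lemma rnormE x : (rnorm x)%:C = `|x|.
Proof. by rewrite RRe_real// normr_real. Qed.

Lemma rnorm_ge0 x : 0 <= rnorm x.
Proof. by rewrite -ler0c rnormE. Qed.

Lemma rnorm0 : rnorm (0 : V) = 0.
Proof. by rewrite /rnorm normr0. Qed.

Lemma rnorm_eq0 x : rnorm x = 0 -> x = 0.
Proof. by move=> h; apply/normr0_eq0; rewrite -rnormE h. Qed.

Lemma rnormD x y : rnorm (x + y) <= rnorm x + rnorm y.
Proof. by rewrite -lecR rmorphD/= !rnormE ler_normD. Qed.

Lemma rnormN x : rnorm (- x) = rnorm x.
Proof. by rewrite /rnorm normrN. Qed.

Lemma rnormZ (k : Cx R) x : rnorm (k *: x) = rnorm k * rnorm x.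
Proof. by apply: complexI; rewrite rmorphM/= !rnormE normrZ. Qed.

End RealNorm.

Section BoundedLinearMaps.
Context {R : realType}.
Implicit Types V W : normedModType (Cx R).

Definition bounded_linear V W : {pred V -> W} :=
  [pred f : V -> W |
    `[< linear f /\ exists M : R, forall x, rnorm (f x) <= M * rnorm x >]].

Arguments bounded_linear V W : clear implicits.

(* The Banach (here: normed) space of bounded linear maps, with the operator
   norm. *)
Record blin V W := Blin {
  blin_fun :> V -> W;
  blin_subproof : blin_fun \in bounded_linear V W }.

HB.instance Definition _ V W := [isSub for @blin_fun V W].
HB.instance Definition _ V W := [Choice of blin V W by <:].

Lemma bounded_linear_submod V W : submod_closed (bounded_linear V W).
Proof.
split=> [|k f g /asboolP[fl [M fM]] /asboolP[gl [N gN]]]; apply/asboolP.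
  split=> [a x y /=|]; first by rewrite scaler0 addr0.
  by exists 0 => x /=; rewrite rnorm0 mul0r.
split=> [a x y /=|].
  by rewrite !fctE fl gl !scalerDr !scalerA (mulrC k) addrACA -!scalerA -!scalerDr.
exists (rnorm k * M + N) => x; rewrite mulrDl -mulrA.
by rewrite (le_trans (rnormD _ _))// lerD// rnormZ ler_wpM2l ?rnorm_ge0.
Qed.

HB.instance Definition _ V W :=
  GRing.isSubmodClosed.Build (Cx R) (V -> W) (bounded_linear V W)
    (bounded_linear_submod V W).
HB.instance Definition _ V W := [SubChoice_isSubLmodule of blin V W by <:].

Lemma blinP V W (f g : blin V W) : f =1 g -> f = g.
Proof. by move=> fg; apply/val_inj/funext. Qed.

Lemma blinDZE V W (k : Cx R) (f g : blin V W) x :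
  (k *: f + g) x = k *: f x + g x.
Proof. by []. Qed.

Lemma blin_linear V W (f : blin V W) : linear f.
Proof. by have /asboolP[] := blin_subproof f. Qed.

Lemma blin_bounded V W (f : blin V W) :
  exists M : R, forall x, rnorm (f x) <= M * rnorm x.
Proof. by have /asboolP[] := blin_subproof f. Qed.

HB.instance Definition _ V W (f : blin V W) :=
  GRing.isLinear.Build (Cx R) V W _ f (blin_linear f).

Definition opnorm V W (f : blin V W) : R :=
  sup [set rnorm (f x) | x in [set x | rnorm x <= 1]].

Lemma opnorm_has_sup V W (f : blin V W) :
  has_sup [set rnorm (f x) | x in [set x | rnorm x <= 1]].
Proof.
split; first by exists (rnorm (f 0)), 0; rewrite //= rnorm0.
have [M fM] := blin_bounded f; exists `|M| => _ [x /= x1 <-].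
rewrite (le_trans (fM x))// (le_trans (ler_norm _))// normrM.
by rewrite (ger0_norm (rnorm_ge0 x)) ler_piMr.
Qed.

Lemma opnorm_ub V W (f : blin V W) x : rnorm x <= 1 -> rnorm (f x) <= opnorm f.
Proof. by move=> x1; apply: (sup_upper_bound (opnorm_has_sup f)); exists x. Qed.

Lemma opnorm_ge0 V W (f : blin V W) : 0 <= opnorm f.
Proof.
by rewrite (le_trans _ (opnorm_ub f (x := 0) _)) ?rnorm_ge0 ?rnorm0.
Qed.

Lemma opnormP V W (f : blin V W) x : rnorm (f x) <= opnorm f * rnorm x.
Proof.
have [->|x0] := eqVneq x 0; first by rewrite linear0 !rnorm0 mulr0.
have nx0 : 0 < rnorm x.
  by rewrite lt0r rnorm_ge0 andbT; apply: contra_neq x0; apply: rnorm_eq0.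
have nxV : rnorm ((rnorm x)^-1%:C : Cx R) = (rnorm x)^-1.
  by rewrite /rnorm ger0_norm ?ler0c ?invr_ge0 ?rnorm_ge0.
have := @opnorm_ub _ _ f ((rnorm x)^-1%:C *: x).
rewrite linearZ/= !rnormZ nxV mulVf ?gt_eqF// => /(_ (lexx _)).
by rewrite ler_pdivrMl// mulrC.
Qed.

Lemma opnorm_le V W (f : blin V W) (M : R) : 0 <= M ->
  (forall x, rnorm (f x) <= M * rnorm x) -> opnorm f <= M.
Proof.
move=> M0 fM; apply: ge_sup; first by have [] := opnorm_has_sup f.
by move=> _ [x /= x1 <-]; rewrite (le_trans (fM x))// ler_piMr.
Qed.

Lemma opnormD V W (f g : blin V W) : opnorm (f + g) <= opnorm f + opnorm g.
Proof.
apply: opnorm_le => [|x]; first by rewrite addr_ge0 ?opnorm_ge0.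
by rewrite (le_trans (rnormD _ _))// mulrDl lerD ?opnormP.
Qed.

Lemma opnormZ_le V W (k : Cx R) (f : blin V W) :
  opnorm (k *: f) <= rnorm k * opnorm f.
Proof.
apply: opnorm_le => [|x]; first by rewrite mulr_ge0 ?opnorm_ge0 ?rnorm_ge0.
by rewrite rnormZ -mulrA ler_wpM2l ?rnorm_ge0 ?opnormP.
Qed.

Lemma opnormZ V W (k : Cx R) (f : blin V W) :
  opnorm (k *: f) = rnorm k * opnorm f.
Proof.
apply/eqP; rewrite eq_le opnormZ_le/=.
have [->|k0] := eqVneq k 0; first by rewrite rnorm0 mul0r opnorm_ge0.
have nk0 : 0 < rnorm k.
  rewrite lt0r rnorm_ge0 andbT; apply: contra_neq k0.
  exact: (@rnorm_eq0 R (Cx R)).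
rewrite -ler_pdivlMl//; have := opnormZ_le k^-1 (k *: f).
rewrite scalerA mulVf// scale1r; congr (_ <= _ * _).
by apply: complexI; rewrite fmorphV/= !rnormE normfV.
Qed.

Lemma opnorm0_eq0 V W (f : blin V W) : opnorm f = 0 -> f = 0.
Proof.
move=> f0; apply: blinP => x; apply: rnorm_eq0; apply/le_anti.
by rewrite rnorm_ge0 andbT (le_trans (opnormP f x))// f0 mul0r.
Qed.

Section Normed.
Context {V W : normedModType (Cx R)}.
Let nrm (f : blin V W) : Cx R := (opnorm f)%:C.
Let nrmD f g : nrm (f + g) <= nrm f + nrm g.
Proof. by rewrite -rmorphD/= lecR opnormD. Qed.
Let nrmZ (k : Cx R) f : nrm (k *: f) = `|k| * nrm f.
Proof. by rewrite /nrm opnormZ rmorphM/= rnormE. Qed.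
Let nrm0 f : nrm f = 0 -> f = 0.
Proof. by move/complexI/opnorm0_eq0. Qed.
HB.instance Definition _ := Lmodule_isNormed.Build (Cx R) (blin V W) nrmD nrmZ nrm0.
End Normed.

Lemma blin_normE V W (f : blin V W) : `|f| = (opnorm f)%:C.
Proof. by []. Qed.
End BoundedLinearMaps.
Arguments bounded_linear {R} V W.

Section Duality.
Context {R : realType}.
Implicit Types U V W : normedModType (Cx R).

Fact mk_blin_subproof V W (f : V -> W) (M : R) : linear f ->
  (forall x, rnorm (f x) <= M * rnorm x) -> f \in bounded_linear V W.
Proof. by move=> fl fM; apply/asboolP; split=> //; exists M. Qed.

Definition mk_blin V W (f : V -> W) (M : R) (fl : linear f)
  (fM : forall x, rnorm (f x) <= M * rnorm x) : blin V W :=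
  Blin (mk_blin_subproof fl fM).

Lemma opnorm_mk_blin V W (f : V -> W) (M : R) (fl : linear f)
    (fM : forall x, rnorm (f x) <= M * rnorm x) : 0 <= M ->
  opnorm (mk_blin fl fM) <= M.
Proof. by move=> M0; apply: opnorm_le. Qed.

Section Comp.
Context {U V W : normedModType (Cx R)} (g : blin V W) (f : blin U V).
Fact blin_comp_linear : linear (g \o f).
Proof. by move=> a x y /=; rewrite !linearP. Qed.
Fact blin_comp_bounded x :
  rnorm ((g \o f) x) <= opnorm g * opnorm f * rnorm x.
Proof.
by rewrite (le_trans (opnormP g _))// -mulrA ler_wpM2l ?opnorm_ge0 ?opnormP.
Qed.
Definition blin_comp : blin U W := mk_blin blin_comp_linear blin_comp_bounded.
End Comp.

Lemma opnorm_comp U V W (g : blin V W) (f : blin U V) :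
  opnorm (blin_comp g f) <= opnorm g * opnorm f.
Proof. by apply: opnorm_mk_blin; rewrite mulr_ge0 ?opnorm_ge0. Qed.

Definition dual V : normedModType (Cx R) := blin V (Cx R).

Section Adjoint.
Context {V W : normedModType (Cx R)} (T : blin V W).
Let adj (phi : dual W) : dual V := blin_comp phi T.
Fact adj_linear : linear adj.
Proof.
by move=> a phi psi; apply: blinP => x; rewrite [RHS]blinDZE [LHS]blinDZE.
Qed.
Fact adj_bounded phi : rnorm (adj phi) <= opnorm T * rnorm phi.
Proof. by rewrite mulrC; exact: opnorm_comp. Qed.
Definition adjoint : blin (dual W) (dual V) := mk_blin adj_linear adj_bounded.
End Adjoint.

Lemma adjointE V W (T : blin V W) (phi : dual W) (x : V) :
  adjoint T phi x = phi (T x).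
Proof. by []. Qed.

Definition biadjoint V W (T : blin V W) : blin (dual (dual V)) (dual (dual W)) :=
  adjoint (adjoint T).

Section Kappa.
Context (V : normedModType (Cx R)).
Section Eval.
Variable x : V.
Let ev (phi : dual V) : Cx R := phi x.
Fact eval_linear : linear ev. Proof. by []. Qed.
Fact eval_bounded phi : rnorm (ev phi) <= rnorm x * rnorm phi.
Proof. by rewrite mulrC; exact: opnormP. Qed.
Definition eval_at : dual (dual V) := mk_blin eval_linear eval_bounded.
End Eval.
Fact kappa_linear : linear eval_at.
Proof. by move=> a x y; apply: blinP => phi /=; rewrite linearP. Qed.
Fact kappa_bounded x : rnorm (eval_at x) <= 1 * rnorm x.
Proof. by rewrite mul1r; apply: opnorm_mk_blin; exact: rnorm_ge0. Qed.
Definition kappa : blin V (dual (dual V)) := mk_blin kappa_linear kappa_bounded.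
End Kappa.

Lemma kappaE V (x : V) (phi : dual V) : kappa V x phi = phi x.
Proof. by []. Qed.

End Duality.

(* Banach algebras are not required to be unital, so that MathComp's ring
   structures do not apply. *)
HB.mixin Record isBanachAlgebra (R : realType) A
    of CompleteNormedModule (Cx R) A := {
  bamul : A -> A -> A ;
  bamulA : associative bamul ;
  bamul_linearl : forall b, linear (bamul^~ b) ;
  bamul_linearr : forall a, linear (bamul a) ;
  bamul_norm : forall a b, `|bamul a b| <= `|a| * `|b| }.

#[short(type="banachAlgType")]
HB.structure Definition BanachAlgebra (R : realType) :=
  { A of CompleteNormedModule (Cx R) A & isBanachAlgebra R A }.

Section ProjectiveTensor.
Context {R : realType}.

Definition bounded_bilinear (A B Y : normedModType (Cx R))
    (beta : A -> B -> Y) (M : R) : Prop :=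
  [/\ forall b, linear (beta^~ b), forall a, linear (beta a)
    & forall a b, rnorm (beta a b) <= M * (rnorm a * rnorm b)].

(* A projective tensor product of A and B, given by its universal property
   among Banach spaces.  The bound on opnorm F makes it unique up to a unique
   isometric isomorphism compatible with the elementary tensors. *)
Record proj_tensor (A B : completeNormedModType (Cx R)) := ProjTensor {
  pt_space :> completeNormedModType (Cx R) ;
  tens : A -> B -> pt_space ;
  tens_bilinear : bounded_bilinear tens 1 ;
  tens_universal : forall (Y : completeNormedModType (Cx R))
      (beta : A -> B -> Y) (M : R), 0 <= M -> bounded_bilinear beta M ->
    exists F : blin pt_space Y,
      [/\ forall a b, F (tens a b) = beta a b, opnorm F <= M
        & forall G : blin pt_space Y,
            (forall a b, G (tens a b) = beta a b) -> G = F] }.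

Section Lift.
Context {A B : completeNormedModType (Cx R)} (P : proj_tensor A B).
Context {Y : completeNormedModType (Cx R)} (beta : A -> B -> Y) (M : R).
Hypotheses (M0 : 0 <= M) (betaM : bounded_bilinear beta M).

Definition tens_lift : blin P Y := sval (cid (tens_universal P M0 betaM)).

Lemma tens_liftE a b : tens_lift (tens P a b) = beta a b.
Proof. by rewrite /tens_lift; case: cid => F /= []. Qed.

Lemma tens_lift_norm : opnorm tens_lift <= M.
Proof. by rewrite /tens_lift; case: cid => F /= []. Qed.

Lemma tens_lift_uniq (G : blin P Y) :
  (forall a b, G (tens P a b) = beta a b) -> G = tens_lift.
Proof. by rewrite /tens_lift; case: cid => F /= [_ _]; exact. Qed.

End Lift.
End ProjectiveTensor.

Section Biflat.
Context {R : realType} (A : banachAlgType R).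

Lemma bamul_rnorm (a b : A) : rnorm (bamul a b) <= rnorm a * rnorm b.
Proof. by rewrite -lecR rmorphM/= !rnormE bamul_norm. Qed.

Section Maps.
Variable P : proj_tensor A A.

Fact bamul_bounded_bilinear : bounded_bilinear (@bamul R A) 1.
Proof.
split=> *; [exact: bamul_linearl|exact: bamul_linearr|].
by rewrite mul1r bamul_rnorm.
Qed.

Definition prod_map : blin P A := tens_lift P ler01 bamul_bounded_bilinear.

Fact lact_bounded_bilinear a :
  bounded_bilinear (fun b c => tens P (bamul a b) c) (rnorm a).
Proof.
have [l r n] := tens_bilinear P; split=> [c k x y|b|b c].
- by rewrite bamul_linearr l.
- exact: r.
- rewrite (le_trans (n _ _))// mul1r mulrA ler_wpM2r ?rnorm_ge0//.
  exact: bamul_rnorm.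
Qed.

Definition lact a : blin P P :=
  tens_lift P (rnorm_ge0 a) (lact_bounded_bilinear a).

Fact ract_bounded_bilinear a :
  bounded_bilinear (fun b c => tens P b (bamul c a)) (rnorm a).
Proof.
have [l r n] := tens_bilinear P; split=> [c|b k x y|b c].
- exact: l.
- by rewrite bamul_linearl r.
- rewrite (le_trans (n _ _))// mul1r mulrCA ler_wpM2l ?rnorm_ge0//.
  by rewrite mulrC bamul_rnorm.
Qed.

Definition ract a : blin P P :=
  tens_lift P (rnorm_ge0 a) (ract_bounded_bilinear a).

Lemma prod_mapE a b : prod_map (tens P a b) = bamul a b.
Proof. exact: tens_liftE. Qed.

Lemma lactE a b c : lact a (tens P b c) = tens P (bamul a b) c.
Proof. exact: tens_liftE. Qed.

Lemma ractE a b c : ract a (tens P b c) = tens P b (bamul c a).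
Proof. exact: tens_liftE. Qed.

(* The left and right actions of a on (A (x) A)'' are the second adjoints of
   b (x) c |-> ab (x) c and b (x) c |-> b (x) ca. *)
Definition biflat_with : Prop :=
  exists sigma : blin A (dual (dual P)),
    [/\ forall a b, sigma (bamul a b) = biadjoint (lact a) (sigma b),
        forall a b, sigma (bamul a b) = biadjoint (ract b) (sigma a)
      & forall a, biadjoint prod_map (sigma a) = kappa A a].

End Maps.

(* The choice of the tensor product is immaterial: see biflat_with_indep. *)
Definition biflat : Prop := exists P : proj_tensor A A, biflat_with P.

Lemma biflat_with_indep (P Q : proj_tensor A A) : biflat_with P -> biflat_with Q.
Proof.
move=> [sigma [sl sr sp]].
pose U : blin P Q := tens_lift P ler01 (tens_bilinear Q).
have UE a b : U (tens P a b) = tens Q a b by exact: tens_liftE.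
have uniq (Y : completeNormedModType (Cx R)) (F G : blin P Y) (M : R)
    (beta : A -> A -> Y) (M0 : 0 <= M) (bM : bounded_bilinear beta M) :
    (forall a b, F (tens P a b) = beta a b) ->
    (forall a b, G (tens P a b) = beta a b) -> F = G.
  by move=> /(tens_lift_uniq M0 bM) -> /(tens_lift_uniq M0 bM) ->.
have Ul a : blin_comp (lact Q a) U = blin_comp U (lact P a).
  apply: (uniq _ _ _ _ _ (rnorm_ge0 a) (lact_bounded_bilinear Q a)) => b c /=.
    by rewrite UE lactE.
  by rewrite lactE UE.
have Ur a : blin_comp (ract Q a) U = blin_comp U (ract P a).
  apply: (uniq _ _ _ _ _ (rnorm_ge0 a) (ract_bounded_bilinear Q a)) => b c /=.
    by rewrite UE ractE.
  by rewrite ractE UE.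
have Up : blin_comp (prod_map Q) U = prod_map P.
  apply: (uniq _ _ _ _ _ ler01 bamul_bounded_bilinear) => b c /=.
    by rewrite UE prod_mapE.
  by rewrite prod_mapE.
have bic (V1 V2 V3 : normedModType (Cx R)) (g : blin V2 V3) (f : blin V1 V2) x :
    biadjoint g (biadjoint f x) = biadjoint (blin_comp g f) x.
  by apply: blinP => phi /=; congr (x _); apply: blinP.
have sE a : blin_comp (biadjoint U) sigma a = biadjoint U (sigma a) by [].
exists (blin_comp (biadjoint U) sigma); split=> a => [b|b|].
- by rewrite !sE sl !bic Ul.
- by rewrite !sE sr !bic Ur.
- by rewrite sE bic Up sp.
Qed.

End Biflat.

Section RealSums.
Context {R : realType} {I : choiceType}.
Implicit Types (D : set I) (a b : I -> R).

Definition psum D a : R := fine (\esum_(i in D) (a i)%:E).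
Definition psummable D a := (\esum_(i in D) (a i)%:E < +oo)%E.

Lemma psum_ge0 D a : (forall i, 0 <= a i) -> 0 <= psum D a.
Proof. by move=> a0; apply: fine_ge0; apply: esum_ge0 => i _; rewrite lee_fin. Qed.

Lemma psumK D a : (forall i, 0 <= a i) -> psummable D a ->
  (psum D a)%:E = \esum_(i in D) (a i)%:E.
Proof.
move=> a0 sa; rewrite /psum fineK// ge0_fin_numE//.
by apply: esum_ge0 => i _; rewrite lee_fin.
Qed.

Lemma psummable_le D a b : (forall i, a i <= b i) ->
  psummable D b -> psummable D a.
Proof. by move=> ab; apply: le_lt_trans; apply: le_esum => i _; rewrite lee_fin. Qed.

Lemma psum_le D a b : (forall i, 0 <= a i) -> (forall i, a i <= b i) ->
  psummable D b -> psum D a <= psum D b.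
Proof.
move=> a0 ab sb; have sa := psummable_le ab sb.
have b0 i : 0 <= b i by exact: le_trans (ab i).
by rewrite -lee_fin !psumK//; apply: le_esum => i _; rewrite lee_fin.
Qed.

Lemma psumDE D a b : (forall i, 0 <= a i) -> (forall i, 0 <= b i) ->
  (\esum_(i in D) (a i + b i)%:E =
   \esum_(i in D) (a i)%:E + \esum_(i in D) (b i)%:E)%E.
Proof.
by move=> a0 b0; rewrite -esumD// => i _; rewrite lee_fin.
Qed.

Lemma psummableD D a b : (forall i, 0 <= a i) -> (forall i, 0 <= b i) ->
  psummable D a -> psummable D b -> psummable D (fun i => a i + b i).
Proof. by move=> a0 b0 sa sb; rewrite /psummable psumDE// lte_add_pinfty. Qed.

Lemma psumD D a b : (forall i, 0 <= a i) -> (forall i, 0 <= b i) ->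
  psummable D a -> psummable D b ->
  psum D (fun i => a i + b i) = psum D a + psum D b.
Proof.
move=> a0 b0 sa sb; apply: EFin_inj; rewrite EFinD !psumK//; first exact: psumDE.
- by move=> i; rewrite addr_ge0.
- exact: psummableD.
Qed.

Lemma psumZE D a (k : R) : 0 <= k ->
  (\esum_(i in D) (k * a i)%:E = k%:E * \esum_(i in D) (a i)%:E)%E.
Proof.
move=> k0; rewrite /esum -ereal_supZl//; last first.
  by apply/set0P; exists (\sum_(x \in set0) (a x)%:E)%E, set0 => //; split.
congr ereal_sup; apply/seteqP; split=> [x [X [finX XD] <-]|x].
  exists (\sum_(x \in X) (a x)%:E)%E; first by exists X.
  by rewrite !fsumEFin//= -EFinM; congr EFin; rewrite !fsbig_finite//= mulr_sumr.
move=> [_ [X [finX XD] <-] <-]; exists X => //.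
by rewrite !fsumEFin//= -EFinM; congr EFin; rewrite !fsbig_finite//= mulr_sumr.
Qed.

Lemma psummableZ D a (k : R) : (forall i, 0 <= a i) -> 0 <= k ->
  psummable D a -> psummable D (fun i => k * a i).
Proof.
by move=> a0 k0 sa; rewrite /psummable psumZE// -psumK// -EFinM ltry.
Qed.

Lemma psumZ D a (k : R) : (forall i, 0 <= a i) -> 0 <= k -> psummable D a ->
  psum D (fun i => k * a i) = k * psum D a.
Proof. by move=> a0 k0 sa; rewrite /psum psumZE// -psumK. Qed.

(* rsum and csum are the sums of absolutely summable real and complex families;
   esum alone is only meaningful for nonnegative terms. *)
Definition rsum D (f : I -> R) : R :=
  fine (\esum_(i in D) (Num.max (f i) 0)%:E)
  - fine (\esum_(i in D) (Num.max (- f i) 0)%:E).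

Definition asummable D (f : I -> R) := psummable D (fun i => `|f i|).

Let pos_ge0 (f : I -> R) i : 0 <= Num.max (f i) 0.
Proof. by rewrite le_max lexx orbT. Qed.

Let pos_le (f : I -> R) i : Num.max (f i) 0 <= `|f i|.
Proof. by rewrite ge_max ler_norm normr_ge0. Qed.

Let neg_le (f : I -> R) i : Num.max (- f i) 0 <= `|f i|.
Proof. by rewrite -normrN ge_max ler_norm normr_ge0. Qed.

Let asummable_pos D f : asummable D f -> psummable D (fun i => Num.max (f i) 0).
Proof. by apply: psummable_le => i; exact: pos_le. Qed.

Let asummable_neg D f :
  asummable D f -> psummable D (fun i => Num.max (- f i) 0).
Proof. by apply: psummable_le => i; exact: neg_le. Qed.

Let posneg (x : R) : x = Num.max x 0 - Num.max (- x) 0.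
Proof. by rewrite !maxEle; case: ifP; case: ifP; lra. Qed.

Lemma rsumB D a b : (forall i, 0 <= a i) -> (forall i, 0 <= b i) ->
  psummable D a -> psummable D b ->
  rsum D (fun i => a i - b i) = psum D a - psum D b.
Proof.
move=> a0 b0 sa sb; rewrite /rsum -!/(psum _ _).
set f := fun i => a i - b i.
have sf : asummable D f.
  apply: (psummable_le _ (psummableD a0 b0 sa sb)) => i.
  by rewrite (le_trans (ler_normB _ _))// !ger0_norm.
suff : psum D (fun i => Num.max (f i) 0) + psum D b =
       psum D (fun i => Num.max (- f i) 0) + psum D a by lra.
have sp := asummable_pos sf; have sn := asummable_neg sf.
have p0 i : 0 <= Num.max (f i) 0 by exact: pos_ge0.
have n0 i : 0 <= Num.max (- f i) 0 by exact: (pos_ge0 (fun i => - f i)).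
rewrite -!psumD//.
congr fine; apply: eq_esum => i _; congr EFin.
by have := posneg (f i); rewrite /f/=; lra.
Qed.

Lemma rsumE D f : asummable D f -> rsum D f =
  psum D (fun i => Num.max (f i) 0) - psum D (fun i => Num.max (- f i) 0).
Proof. by []. Qed.

Lemma rsumD D f g : asummable D f -> asummable D g ->
  rsum D (fun i => f i + g i) = rsum D f + rsum D g.
Proof.
move=> sf sg; pose n (f : I -> R) i := Num.max (- f i) 0.
pose p (f : I -> R) i := Num.max (f i) 0.
have p0 h i : 0 <= p h i by exact: pos_ge0.
have n0 h i : 0 <= n h i by exact: (pos_ge0 (fun i => - h i)).
have [spf spg] := (asummable_pos sf, asummable_pos sg).
have [snf sng] := (asummable_neg sf, asummable_neg sg).
have -> : (fun i => f i + g i) =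
          (fun i => (p f i + p g i) - (n f i + n g i)).
  by apply/funext => i; rewrite {1}(posneg (f i)) {1}(posneg (g i)) /p /n; lra.
rewrite rsumB; do ?[by move=> i; rewrite addr_ge0|exact: psummableD].
by rewrite !psumD// !rsumE// /p /n; lra.
Qed.

Lemma rsumZ D f (k : R) : asummable D f ->
  rsum D (fun i => k * f i) = k * rsum D f.
Proof.
move=> sf; have sp := asummable_pos sf; have sn := asummable_neg sf.
have p0 i : 0 <= Num.max (f i) 0 by exact: pos_ge0.
have n0 i : 0 <= Num.max (- f i) 0 by exact: (pos_ge0 (fun i => - f i)).
have [k0|/ltW k0] := leP 0 k.
  have -> : (fun i => k * f i) =
            (fun i => k * Num.max (f i) 0 - k * Num.max (- f i) 0).
    by apply/funext => i; rewrite -mulrBr -posneg.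
  rewrite rsumB; do ?[by move=> i; rewrite mulr_ge0|exact: psummableZ].
  by rewrite !psumZ// -mulrBr.
have k0' : 0 <= - k by rewrite oppr_ge0.
have -> : (fun i => k * f i) =
          (fun i => (- k) * Num.max (- f i) 0 - (- k) * Num.max (f i) 0).
  by apply/funext => i; rewrite -mulrBr mulNr -mulrN opprB -posneg.
rewrite rsumB; do ?[by move=> i; rewrite mulr_ge0|exact: psummableZ].
by rewrite !psumZ// -mulrBr mulNr -mulrN opprB.
Qed.

Lemma rsum_le D f : asummable D f -> rsum D f <= psum D (fun i => `|f i|).
Proof.
move=> sf; have p0 i : 0 <= Num.max (f i) 0 by exact: pos_ge0.
have n0 i : 0 <= Num.max (- f i) 0 by exact: (pos_ge0 (fun i => - f i)).
rewrite rsumE// (@le_trans _ _ (psum D (fun i => Num.max (f i) 0)))//.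
  by rewrite gerBl psum_ge0.
by apply: psum_le => // i; exact: pos_le.
Qed.

End RealSums.

Section ComplexSums.
Context {R : realType}.
Implicit Types z w : Cx R.

Lemma rnormM z w : rnorm (z * w) = rnorm z * rnorm w.
Proof. exact: rnormZ. Qed.

Lemma Re_le_rnorm z : `|complex.Re z| <= rnorm z.
Proof. by rewrite -lecR rnormE normc_ge_Re. Qed.

Lemma rnormi : rnorm ('i%C : Cx R) = 1.
Proof.
by rewrite /rnorm normc_def/= expr0n expr1n add0r sqrtr1.
Qed.

Lemma Im_le_rnorm z : `|complex.Im z| <= rnorm z.
Proof.
have := Re_le_rnorm (z * ('i%C : Cx R)).
by rewrite rnormM rnormi mulr1 (ReiNIm (z : R[i])) normrN.
Qed.

Lemma rnorm_real (x : R) : rnorm (x%:C : Cx R) = `|x|.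
Proof. by rewrite /rnorm normc_def/= expr0n addr0 sqrtr_sqr. Qed.

Lemma rnorm_le_ReIm z : rnorm z <= `|complex.Re z| + `|complex.Im z|.
Proof.
have zE : z = (complex.Re z)%:C + ('i%C : Cx R) * (complex.Im z)%:C.
  exact: (complexE (z : R[i])).
rewrite [in leLHS]zE (le_trans (rnormD _ _))// rnormM rnormi mul1r.
by rewrite !rnorm_real.
Qed.

Context {I : choiceType}.
Implicit Types (D : set I) (f g : I -> Cx R).

Definition csum D f : Cx R :=
  rsum D (fun i => complex.Re (f i)) +i* rsum D (fun i => complex.Im (f i)).

Definition csummable D f := psummable D (fun i => rnorm (f i)).

Let sRe D f : csummable D f -> asummable D (fun i => complex.Re (f i)).
Proof. by apply: psummable_le => i; exact: Re_le_rnorm. Qed.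

Let sIm D f : csummable D f -> asummable D (fun i => complex.Im (f i)).
Proof. by apply: psummable_le => i; exact: Im_le_rnorm. Qed.

Lemma asummableZ D (h : I -> R) k :
  asummable D h -> asummable D (fun i => k * h i).
Proof.
move=> sh; have := psummableZ (fun=> normr_ge0 _) (normr_ge0 k) sh.
by apply: psummable_le => i; rewrite normrM.
Qed.

Lemma csummableZD D f g k : csummable D f -> csummable D g ->
  csummable D (fun i => k * f i + g i).
Proof.
move=> sf sg; have sk := psummableZ (fun=> rnorm_ge0 _) (rnorm_ge0 k) sf.
have k0 i : 0 <= rnorm k * rnorm (f i) by rewrite mulr_ge0 ?rnorm_ge0.
apply: (psummable_le _ (psummableD k0 (fun=> rnorm_ge0 _) sk sg)) => i.
by rewrite (le_trans (rnormD _ _))// rnormM.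
Qed.

Lemma csum_linear D f g k : csummable D f -> csummable D g ->
  csum D (fun i => k * f i + g i) = k * csum D f + csum D g.
Proof.
move=> sf sg; rewrite /csum.
have [[fr fi] [gr gi]] := ((sRe sf, sIm sf), (sRe sg, sIm sg)).
have sZ := asummableZ.
have aD (h1 h2 : I -> R) : asummable D h1 -> asummable D h2 ->
    asummable D (fun i => h1 i + h2 i).
  move=> s1 s2; apply: (psummable_le _ (psummableD _ _ s1 s2)) => i//.
  exact: ler_normD.
case: k => a b.
have -> : (fun i => complex.Re ((a +i* b : Cx R) * f i + g i)) =
  (fun i => (a * complex.Re (f i) + (- b) * complex.Im (f i)) + complex.Re (g i)).
  by apply/funext => i; case: (f i) => ? ?; case: (g i) => ? ? /=; rewrite mulNr.
have -> : (fun i => complex.Im ((a +i* b : Cx R) * f i + g i)) =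
  (fun i => (a * complex.Im (f i) + b * complex.Re (f i)) + complex.Im (g i)).
  by apply/funext => i; case: (f i) => ? ?; case: (g i).
rewrite (rsumD (aD _ _ (sZ _ _ a fr) (sZ _ _ (- b) fi)) gr).
rewrite (rsumD (aD _ _ (sZ _ _ a fi) (sZ _ _ b fr)) gi).
rewrite (rsumD (sZ _ _ a fr) (sZ _ _ (- b) fi)).
rewrite (rsumD (sZ _ _ a fi) (sZ _ _ b fr)).
by rewrite !(rsumZ a fr, rsumZ a fi, rsumZ b fr, rsumZ (- b) fi) mulNr.
Qed.

Lemma csum_bound D f : csummable D f ->
  rnorm (csum D f) <= psum D (fun i => rnorm (f i)).
Proof.
move=> sf; have [z0|z0] := eqVneq (csum D f) 0.
  by rewrite z0 rnorm0 psum_ge0// => i; exact: rnorm_ge0.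
set z := csum D f in z0 *.
pose u : Cx R := `|z| / z.
have uz : u * z = (rnorm z)%:C by rewrite /u divfK// rnormE.
have nu : rnorm u = 1.
  rewrite /rnorm /u normrM normfV normr_id divff ?normr_eq0//.
have s0 : csummable D (fun=> 0 : Cx R).
  apply: (psummable_le _ sf) => i; rewrite rnorm0; exact: rnorm_ge0.
have e0 : csum D (fun=> 0 : Cx R) = 0.
  have := csum_linear 1 s0 s0; rewrite !mul1r addr0.
  by move=> /eqP; rewrite -subr_eq subrr eq_sym => /eqP.
have suf := csummableZD u sf s0.
have := csum_linear u sf s0; rewrite -/z uz e0 addr0 => /(congr1 (@complex.Re R)).
rewrite /csum/= => <-.
rewrite (le_trans (rsum_le (sRe suf)))//; apply: psum_le => // i.
by rewrite (le_trans (Re_le_rnorm _))// addr0 rnormM nu mul1r.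
Qed.

End ComplexSums.

Section Ell1.
Context {R : realType}.
Implicit Types T : choiceType.

Definition ell1_pred T : {pred T -> Cx R} :=
  [pred f : T -> Cx R |
    `[< (\esum_(t in [set: T]) (rnorm (f t))%:E < +oo)%E >]].
Arguments ell1_pred T : clear implicits.

Record ell1 T := Ell1 {
  ell1_fun :> T -> Cx R ;
  ell1_subproof : ell1_fun \in ell1_pred T }.

HB.instance Definition _ T := [isSub for @ell1_fun T].
HB.instance Definition _ T := [Choice of ell1 T by <:].

Lemma ell1_submod T : submod_closed (ell1_pred T).
Proof.
split=> [|k f g /asboolP fs /asboolP gs]; apply/asboolP.
  rewrite (_ : \esum_(_ in _) _ = 0%E) ?ltry//.
  by apply: esum1 => i _ /=; rewrite rnorm0.
exact: (@csummableZD R T setT f g k).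
Qed.

HB.instance Definition _ T :=
  GRing.isSubmodClosed.Build (Cx R) (T -> Cx R) (ell1_pred T) (ell1_submod T).
HB.instance Definition _ T := [SubChoice_isSubLmodule of ell1 T by <:].

Lemma ell1P T (f g : ell1 T) : f =1 g -> f = g.
Proof. by move=> fg; apply/val_inj/funext. Qed.

Lemma ell1_summable T (f : ell1 T) : csummable setT f.
Proof. by have /asboolP := ell1_subproof f. Qed.

Definition ell1_norm T (f : ell1 T) : R :=
  fine (\esum_(t in [set: T]) (rnorm (f t))%:E).

Lemma ell1_normK T (f : ell1 T) :
  (ell1_norm f)%:E = \esum_(t in [set: T]) (rnorm (f t))%:E.
Proof. apply: psumK; [by move=> t; exact: rnorm_ge0|exact: ell1_summable]. Qed.

Lemma ell1_normD T (f g : ell1 T) :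
  ell1_norm (f + g) <= ell1_norm f + ell1_norm g.
Proof.
have [sf sg] := (ell1_summable f, ell1_summable g).
rewrite /ell1_norm -!/(psum _ _) -psumD//; do ?by move=> t; exact: rnorm_ge0.
apply: psum_le => [t|t|]; first exact: rnorm_ge0.
  exact: rnormD.
by apply: psummableD => // t; exact: rnorm_ge0.
Qed.

Lemma ell1_normZ T (k : Cx R) (f : ell1 T) :
  ell1_norm (k *: f) = rnorm k * ell1_norm f.
Proof.
rewrite /ell1_norm -!/(psum _ _) -psumZ ?rnorm_ge0//; last 2 first.
- by move=> t; exact: rnorm_ge0.
- exact: ell1_summable.
by congr psum; apply/funext => t; rewrite -rnormM.
Qed.

Lemma ell1_coord_le T (f : ell1 T) t : rnorm (f t) <= ell1_norm f.
Proof.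
rewrite -lee_fin ell1_normK -[leLHS](@esum_set1 _ _ t (fun t => (rnorm (f t))%:E)).
  rewrite (esumID [set t] setT) ?setTI; last first.
    by move=> i _; rewrite lee_fin rnorm_ge0.
  by rewrite leeDl// esum_ge0// => i _; rewrite lee_fin rnorm_ge0.
by rewrite lee_fin rnorm_ge0.
Qed.

Lemma ell1_norm0_eq0 T (f : ell1 T) : ell1_norm f = 0 -> f = 0.
Proof.
move=> f0; apply: ell1P => t; apply: rnorm_eq0; apply/le_anti.
by rewrite rnorm_ge0 andbT -f0 ell1_coord_le.
Qed.

Section Normed.
Context {T : choiceType}.
Let nrm (f : ell1 T) : Cx R := (ell1_norm f)%:C.
Let nrmD f g : nrm (f + g) <= nrm f + nrm g.
Proof. by rewrite -rmorphD/= lecR ell1_normD. Qed.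
Let nrmZ (k : Cx R) f : nrm (k *: f) = `|k| * nrm f.
Proof. by rewrite /nrm ell1_normZ rmorphM/= rnormE. Qed.
Let nrm0 f : nrm f = 0 -> f = 0.
Proof. by move/complexI/ell1_norm0_eq0. Qed.
HB.instance Definition _ :=
  Lmodule_isNormed.Build (Cx R) (ell1 T) nrmD nrmZ nrm0.
End Normed.

Lemma ell1_rnormE T (f : ell1 T) : rnorm f = ell1_norm f.
Proof. by []. Qed.

Section Complete.
Context {T : choiceType}.

Lemma ell1_ballE (f g : ell1 T) (e : R) :
  ball f (e%:C : Cx R) g <-> rnorm (f - g) < e.
Proof. by rewrite -ball_normE /ball_/= -rnormE ltcR. Qed.

Lemma ell1_complete (F : set_system (ell1 T)) :
  ProperFilter F -> cauchy F -> cvg F.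
Proof.
move=> FF /cauchyP Fc.
have Fce (e : R) : 0 < e ->
    exists f0 : ell1 T, \forall f \near F, rnorm (f0 - f) < e.
  move=> e0; have [|f0 Ff0] := Fc (e%:C : Cx R); first by rewrite ltcR.
  exists f0; apply: filterS Ff0 => f; exact: (ell1_ballE _ _ _).1.
have comp (c : ell1 T -> R) : (forall f g, `|c f - c g| <= rnorm (f - g)) ->
    exists l : R, forall e : R, 0 < e -> F [set f | `|l - c f| < e].
  move=> cL; have /R_complete/cvg_ex[l cl] : cauchy (c @ F).
    apply/cauchyP => e e0; have [f0 Ff0] := Fce e e0; exists (c f0).
    by apply: filterS Ff0 => f; exact: le_lt_trans.
  by exists l => e e0; move/cvgrPdist_lt : cl; exact.
have LRe t (f g : ell1 T) :
    `|complex.Re (f t) - complex.Re (g t)| <= rnorm (f - g).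
  apply: le_trans (ell1_coord_le (f - g) t).
  apply: le_trans (Re_le_rnorm (f t - g t)).
  by case: (f t) => ? ?; case: (g t).
have LIm t (f g : ell1 T) :
    `|complex.Im (f t) - complex.Im (g t)| <= rnorm (f - g).
  apply: le_trans (ell1_coord_le (f - g) t).
  apply: le_trans (Im_le_rnorm (f t - g t)).
  by case: (f t) => ? ?; case: (g t).
have [gr grP] := choice (fun t => comp (fun f => complex.Re (f t)) (LRe t)).
have [gi giP] := choice (fun t => comp (fun f => complex.Im (f t)) (LIm t)).
pose g t : Cx R := gr t +i* gi t.
have gP t (e : R) : 0 < e -> F [set f : ell1 T | rnorm (f t - g t) < e].
  move=> e0; have e20 : 0 < e / 2 by lra.
  apply: filterS2 (grP t _ e20) (giP t _ e20) => f fr fi.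
  apply: le_lt_trans (rnorm_le_ReIm (f t - g t)) _.
  have -> : complex.Re (f t - g t) = complex.Re (f t) - gr t by case: (f t).
  have -> : complex.Im (f t - g t) = complex.Im (f t) - gi t by case: (f t).
  by rewrite (splitr e) distrC (distrC (complex.Im _)) ltrD.
have fin (e : R) (f0 : ell1 T) :
    0 < e -> (\forall f \near F, rnorm (f0 - f) < e) ->
    (\esum_(t in [set: T]) (rnorm (f0 t - g t))%:E <= (2 * e)%:E)%E.
  move=> e0 Ff0; apply: ge_ereal_sup => _ [X [finX _] <-].
  set Y := fset_set X; pose d := e / (size Y).+1%:R.
  have d0 : 0 < d by rewrite divr_gt0.
  have FX : F [set f : ell1 T | forall t, t \in Y -> rnorm (f t - g t) < d].
    rewrite (_ : [set f | _] = \bigcap_(t in [set` Y]) [set f : ell1 T |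
      rnorm (f t - g t) < d]); last by apply/seteqP; split=> f /=; exact.
    by apply: filter_bigI => t _; exact: gP.
  have [f [ff0 fX]] := filter_ex (filterI Ff0 FX).
  rewrite fsumEFin// lee_fin fsbig_finite//= -/Y.
  rewrite (@le_trans _ _ (\sum_(t <- Y) (rnorm ((f0 - f) t) + d)))//.
    rewrite big_seq [leRHS]big_seq; apply: ler_sum => t tY.
    rewrite -(subrK (f t) (f0 t)) -addrA (le_trans (rnormD _ _))//.
    by rewrite lerD2l ltW// fX.
  rewrite big_split/= mulr_natl mulr2n lerD//.
    rewrite -lee_fin (le_trans _ (ltW _ : (rnorm (f0 - f))%:E <= e%:E)%E)//.
    rewrite ell1_rnormE ell1_normK; apply: esum_ge; exists X => //.
    by rewrite fsumEFin// fsbig_finite.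
  rewrite big_const_seq count_predT iter_addr_0 -mulr_natr /d mulrAC.
  rewrite -mulrA; apply: ler_piMr; first exact: ltW.
  by rewrite ler_pdivrMr// mul1r ler_nat.
have [f1 Ff1] := Fce 1 ltr01.
have gs : g \in ell1_pred T.
  have gE : g = (fun t => (-1) * (f1 t - g t) + f1 t).
    by apply/funext => t; rewrite mulN1r opprB subrK.
  apply/asboolP; rewrite gE; apply: csummableZD; last exact: ell1_summable.
  exact: le_lt_trans (fin _ _ ltr01 Ff1) (ltry _).
apply/cvg_ex; exists (Ell1 gs); apply/cvgrPdist_lt => e e0.
have eE : e = (complex.Re e)%:C by rewrite RRe_real// gtr0_real.
move: e0; rewrite eE ltcR => e0; set e' := complex.Re e in e0 *.
have e40 : 0 < e' / 4 by lra.
have [f0 Ff0] := Fce _ e40.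
have := fin _ _ e40 Ff0.
rewrite -[leLHS](ell1_normK (f0 - Ell1 gs)) lee_fin -ell1_rnormE => f0g.
apply: filterS Ff0 => f f0f; rewrite -rnormE ltcR.
rewrite -(subrK f0 (Ell1 gs)) -addrA (le_lt_trans (rnormD _ _))//.
rewrite -rnormN opprB; lra.
Qed.

HB.instance Definition _ := Uniform_isComplete.Build (ell1 T) ell1_complete.
End Complete.

End Ell1.
Arguments ell1_pred R T : clear implicits.
Arguments ell1 R T : clear implicits.

Section Convolution.
Context {R : realType} {S : semigroupType}.
Implicit Types (f g h : ell1 R S) (r s t : S).

Definition factorizations r : set (S * S) := [set p | (p.1 * p.2)%g = r].

(* (f * g)(r) is the sum of f s * g t over all pairs with s t = r. *)
Definition conv_fun f g r : Cx R :=
  csum (factorizations r) (fun p => f p.1 * g p.2).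

Let rn0 (I : Type) (F : I -> Cx R) i : 0 <= rnorm (F i).
Proof. exact: rnorm_ge0. Qed.

Lemma esum_prod f g :
  \esum_(p in [set: S * S]) (rnorm (f p.1 * g p.2))%:E =
  (ell1_norm f * ell1_norm g)%:E.
Proof.
rewrite (_ : [set: S * S] = setT `*`` (fun=> setT)); last first.
  by apply/seteqP; split.
rewrite -(@esum_esum _ _ _ setT (fun=> setT)
  (fun s t => (rnorm (f s * g t))%:E)); last by move=> *; rewrite lee_fin.
rewrite mulrC EFinM (ell1_normK f) -psumZE; last first.
  by apply/fine_ge0/esum_ge0 => t _; rewrite lee_fin.
apply: eq_esum => s _; rewrite [in RHS]mulrC EFinM (ell1_normK g) -psumZE//.
by apply: eq_esum => t _; rewrite rnormM.
Qed.

Lemma conv_csummable f g r :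
  csummable (factorizations r) (fun p => f p.1 * g p.2).
Proof.
apply: le_lt_trans (_ : (ell1_norm f * ell1_norm g)%:E < +oo)%E; last first.
  exact: ltry.
rewrite -esum_prod esum_mkcond; apply: le_esum => p _.
by case: ifP => _; rewrite lee_fin.
Qed.

Lemma conv_esum_le f g :
  (\esum_(r in [set: S]) (rnorm (conv_fun f g r))%:E <=
   (ell1_norm f * ell1_norm g)%:E)%E.
Proof.
apply: (@le_trans _ _ (\esum_(r in [set: S])
    \esum_(p in factorizations r) (rnorm (f p.1 * g p.2))%:E)).
  apply: le_esum => r _.
  rewrite -(psumK _ (@conv_csummable f g r)) ?lee_fin//.
  exact/csum_bound/conv_csummable.
rewrite (@esum_esum _ _ _ setT (fun r => factorizations r)
  (fun _ p => (rnorm (f p.1 * g p.2))%:E)); last by move=> *; rewrite lee_fin.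
rewrite -esum_prod le_eqVlt; apply/orP; left; apply/eqP.
apply: (reindex_esum _ _ (fun p : S * S => ((p.1 * p.2)%g, p))).
split=> [p _|p q _ _ [_ ->]|[r p] [_ /= <-]] //.
by exists p.
Qed.

Fact conv_subproof f g : conv_fun f g \in ell1_pred R S.
Proof. by apply/asboolP; exact: le_lt_trans (conv_esum_le f g) (ltry _). Qed.

Definition conv f g : ell1 R S := Ell1 (conv_subproof f g).

Lemma conv_norm f g : ell1_norm (conv f g) <= ell1_norm f * ell1_norm g.
Proof. by rewrite -lee_fin ell1_normK conv_esum_le. Qed.

Lemma conv_linearl g : linear (conv^~ g).
Proof.
move=> k f1 f2; apply: ell1P => r.
rewrite [RHS](_ : _ = k * conv_fun f1 g r + conv_fun f2 g r)//.
rewrite -csum_linear; do ?exact: conv_csummable.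
congr csum; apply/funext => p.
by rewrite [X in X * _ = _](_ : _ = k * f1 p.1 + f2 p.1)// mulrDl mulrA.
Qed.

Lemma conv_linearr f : linear (conv f).
Proof.
move=> k g1 g2; apply: ell1P => r.
rewrite [RHS](_ : _ = k * conv_fun f g1 r + conv_fun f g2 r)//.
rewrite -csum_linear; do ?exact: conv_csummable.
congr csum; apply/funext => p.
by rewrite [X in _ * X = _](_ : _ = k * g1 p.2 + g2 p.2)// mulrDr mulrCA.
Qed.

End Convolution.

Section Basis.
Context {R : realType}.

Lemma delta_esum (T : choiceType) (D : set T) t (z : Cx R) :
  \esum_(s in D) (rnorm (if s == t then z else 0))%:E =
  (if t \in D then rnorm z else 0)%:E.
Proof.
rewrite (_ : \esum_(s in D) _ = \esum_(s in D `&` [set t]) (rnorm z)%:E).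
  case: ifPn => tD.
    rewrite (_ : D `&` _ = [set t]) ?esum_set1 ?lee_fin ?rnorm_ge0//.
    by apply/seteqP; split=> [x []//|x /= ->]; split=> //; apply: set_mem.
  rewrite (_ : D `&` _ = set0) ?esum_set0//.
  apply/seteqP; split=> // x [/= Dx xt]; move: tD; rewrite -xt notin_setE; exact.
rewrite esum_mkcondr; apply: eq_esum => s _.
rewrite (_ : (s \in [set t]) = (s == t)); last by apply/idP/eqP; rewrite inE.
by case: ifP => // _; rewrite rnorm0.
Qed.

Fact delta_subproof (T : choiceType) (t : T) :
  (fun s => if s == t then 1 else 0 : Cx R) \in ell1_pred R T.
Proof. by apply/asboolP; rewrite delta_esum ltry. Qed.

Definition delta (T : choiceType) (t : T) : ell1 R T :=
  Ell1 (delta_subproof t).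

Lemma csum_delta (I : choiceType) (D : set I) (q : I) :
  csum D (fun p => if p == q then 1 else 0 : Cx R) = if q \in D then 1 else 0.
Proof.
have P (F : I -> R) (k : R) :
    (forall p, F p = if p == q then k else 0) -> 0 <= k ->
    fine (\esum_(i in D) (F i)%:E) = if q \in D then k else 0.
  move=> FE k0.
  rewrite (_ : \esum_(p in D) _ =
    \esum_(p in D) (rnorm (if p == q then k%:C : Cx R else 0))%:E).
    by rewrite delta_esum/= rnorm_real ger0_norm.
  apply: eq_esum => p _; rewrite FE; case: ifP => _; rewrite ?rnorm0//.
  by rewrite rnorm_real ger0_norm.
rewrite /csum /rsum (P _ 1) ?ler01//; last first.
  by move=> p; case: ifP => _; rewrite /= maxEle ?ler10// lexx.
rewrite (P _ 0)//; last first.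
  by move=> p; case: ifP => _; rewrite /= ?oppr0 ?maxxx// maxEle lerN10.
rewrite (P _ 0)//; last by move=> p; case: ifP => _; rewrite /= maxxx.
rewrite (P _ 0)//; last by move=> p; case: ifP => _; rewrite /= oppr0 maxxx.
by case: ifP => _; rewrite subr0 ?subrr.
Qed.

Lemma conv_delta (S : semigroupType) (s t : S) :
  conv (delta s) (delta t) = delta (s * t)%g.
Proof.
apply: ell1P => r.
rewrite [LHS](_ : _ = csum (factorizations r)
  (fun p => if p == (s, t) then 1 else 0 : Cx R)); last first.
  congr csum; apply/funext => -[a b] /=.
  by rewrite xpair_eqE; case: ifP => _ /=; rewrite ?mul1r ?mul0r.
rewrite csum_delta; congr (if _ then _ else _).
by apply/idP/eqP => [/set_mem/= ->|->]; rewrite ?inE.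
Qed.

Lemma ell1_approx (T : choiceType) (f : ell1 R T) (e : R) : 0 < e ->
  exists X : seq T, rnorm (f - \sum_(t <- X) f t *: delta t) < e.
Proof.
move=> e0; have : ((ell1_norm f - e)%:E < (ell1_norm f)%:E)%E.
  by rewrite lte_fin; lra.
rewrite [ltRHS]ell1_normK => /ereal_sup_gt[_ [X [finX _] <-]].
rewrite fsumEFin// lte_fin fsbig_finite//=; set Y := fset_set X => fX.
exists Y; rewrite ell1_rnormE.
have sE s : (\sum_(t <- Y) f t *: delta t) s = if s \in Y then f s else 0.
  rewrite [LHS](_ : _ = \sum_(t <- Y) f t * (if s == t then 1 else 0)); last first.
    by elim/big_ind2 : _ => // x1 x2 y1 y2 <- <-.
  case: ifPn => sY.
    rewrite (big_fsetD1 s)//= eqxx mulr1 big_seq big1 ?addr0// => t.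
    by rewrite !inE eq_sym => /andP[/negPf -> _]; rewrite mulr0.
  rewrite big_seq big1// => t tY; case: eqP => [st|_]; rewrite ?mulr0//.
  by move: sY; rewrite st tY.
suff : ell1_norm f = \sum_(t <- Y) rnorm (f t) +
    ell1_norm (f - \sum_(t <- Y) f t *: delta t) by lra.
apply: EFin_inj; rewrite EFinD !ell1_normK (esumID X setT); last first.
  by move=> t _; rewrite lee_fin rnorm_ge0.
rewrite !setTI; congr (_ + _)%E.
  rewrite -fsbig_finite// -fsumEFin// -esum_fset//; last first.
    by move=> t _; rewrite lee_fin rnorm_ge0.
rewrite esum_mkcond; apply: eq_esum => t _.
rewrite [X in _ = (rnorm X)%:E](_ : _ = f t - (\sum_(t <- Y) f t *: delta t) t)//.
rewrite sE in_fset_set// in_setC; case: (t \in X) => /=; last by rewrite subr0.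
by rewrite subrr rnorm0.
Qed.

Lemma ell1_dense (T : choiceType) (P : ell1 R T -> Prop) : P 0 ->
  (forall t, P (delta t)) ->
  (forall k f g, P f -> P g -> P (k *: f + g)) ->
  (forall f, (forall e : R, 0 < e -> exists2 g, P g & rnorm (f - g) < e) -> P f) ->
  forall f, P f.
Proof.
move=> P0 Pd Pl Pc f; apply: Pc => e e0; have [X Xe] := ell1_approx f e0.
exists (\sum_(t <- X) f t *: delta t) => //.
by elim: X {Xe} => [|t X IH]; rewrite ?big_nil// big_cons; apply: Pl.
Qed.

End Basis.

Section ConvAssoc.
Context {R : realType} {S : semigroupType}.
Implicit Types f g h : ell1 R S.

Let T f g h := conv f (conv g h) - conv (conv f g) h.

Let convBl g f1 f2 : conv (f1 - f2) g = conv f1 g - conv f2 g.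
Proof. by rewrite addrC -scaleN1r conv_linearl scaleN1r addrC. Qed.

Let convBr f g1 g2 : conv f (g1 - g2) = conv f g1 - conv f g2.
Proof. by rewrite addrC -scaleN1r conv_linearr scaleN1r addrC. Qed.

Let T_norm f g h :
  rnorm (T f g h) <= 2 * (rnorm f * rnorm g * rnorm h).
Proof.
rewrite (le_trans (rnormD _ _))// rnormN mulr_natl mulr2n !ell1_rnormE lerD//.
  rewrite (le_trans (conv_norm _ _))// -mulrA ler_wpM2l ?conv_norm//.
  by rewrite -ell1_rnormE rnorm_ge0.
rewrite (le_trans (conv_norm _ _))// ler_wpM2r ?conv_norm//.
by rewrite -ell1_rnormE rnorm_ge0.
Qed.

Let T_linear1 g h : linear (fun f => T f g h).
Proof.
by move=> k f1 f2; rewrite /T !conv_linearl scalerBr opprD addrACA.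
Qed.

Let T_linear2 f h : linear (fun g => T f g h).
Proof.
move=> k f1 f2; rewrite /T conv_linearl conv_linearr conv_linearr conv_linearl.
by rewrite scalerBr opprD addrACA.
Qed.

Let T_linear3 f g : linear (fun h => T f g h).
Proof. by move=> k f1 f2; rewrite /T !conv_linearr scalerBr opprD addrACA. Qed.

Let vanish (L : ell1 R S -> ell1 R S) (M : R) : linear L ->
  (forall f, rnorm (L f) <= M * rnorm f) -> (forall t, L (delta t) = 0) ->
  forall f, L f = 0.
Proof.
move=> Ll LM Ld; have LB f g : L (f - g) = L f - L g.
  exact: (linearB (mk_blin Ll LM)).
apply: ell1_dense => [|//|k f g f0 g0|f fP].
- by have := LB 0 0; rewrite !subrr.
- by rewrite Ll f0 g0 scaler0 addr0.
apply: rnorm_eq0; apply/eqP; rewrite eq_le rnorm_ge0 andbT leNgt; apply/negP => Lf.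
have M0 : 0 < `|M| + 1 by rewrite ltr_wpDl.
have [g g0] := fP _ (divr_gt0 Lf M0).
rewrite ltr_pdivlMr//.
have : rnorm (L f) <= rnorm (f - g) * (`|M| + 1).
  rewrite -[L f]subr0 -g0 -LB (le_trans (LM _))// mulrC ler_wpM2l ?rnorm_ge0//.
  by rewrite (le_trans (ler_norm _))// lerDl.
lra.
Qed.

Lemma convA : associative (@conv R S).
Proof.
move=> f g h; apply/eqP; rewrite -subr_eq0; apply/eqP; rewrite -/(T f g h).
apply: (vanish (M := 2 * rnorm f * rnorm g) (T_linear3 f g)) => [h'|t].
  by rewrite (le_trans (T_norm _ _ _))// !mulrA.
apply: (vanish (M := 2 * rnorm f * rnorm (delta t : ell1 R S))
          (T_linear2 f (delta t))) => [g'|s].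
  by rewrite (le_trans (T_norm _ _ _))// mulrAC !mulrA.
apply: (vanish (M := 2 * rnorm (delta s : ell1 R S) * rnorm (delta t : ell1 R S))
          (T_linear1 (delta s) (delta t))) => [f'|r].
  by rewrite (le_trans (T_norm _ _ _))// -!mulrA ler_wpM2l// mulrC -mulrA.
by rewrite /T !conv_delta mulgA subrr.
Qed.

Let conv_cnorm f g : `|conv f g| <= `|f| * `|g|.
Proof. by rewrite -!rnormE -rmorphM/= lecR conv_norm. Qed.

HB.instance Definition _ := isBanachAlgebra.Build R (ell1 R S)
  convA conv_linearl conv_linearr conv_cnorm.

End ConvAssoc.
Definition conv_alg (R : realType) (S : semigroupType) : banachAlgType R :=
  ell1 R S.

Section CliffordSemigroups.
Context (S : semigroupType).
Local Open Scope group_scope.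

Definition inverse_semigroup : Prop :=
  forall a : S, exists! b : S, a * b * a = a /\ b * a * b = b.

Definition clifford_semigroup : Prop :=
  inverse_semigroup /\ forall e a : S, e * e = e -> e * a = a * e.

Definition idem : Type := {e : S | e * e == e}.

Definition idem_le (e f : idem) : Prop := val e * val f = val e.

Definition uniformly_locally_finite : Prop :=
  exists N : nat, forall f : idem, ([set y : idem | idem_le y f] #<= `I_N)%card.

End CliffordSemigroups.

Section MaximalSubgroup.
Context {S : semigroupType} (e : idem S).
Local Open Scope group_scope.

(* The maximal subgroup with identity e consists of the units of the monoid
   eSe; maxgroup_maximal shows that it contains every such subgroup. *)
Definition maxgroup_pred : pred S :=
  [pred a : S | `[< [/\ val e * a = a, a * val e = a
    & exists b, [/\ val e * b = b, b * val e = b, a * b = val e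
                  & b * a = val e]] >]].

Record maxgroup := MaxGroup {
  maxgroup_val : S ;
  maxgroup_subproof : maxgroup_pred maxgroup_val }.

HB.instance Definition _ := [isSub for maxgroup_val].
HB.instance Definition _ := [Choice of maxgroup by <:].

Let ee : val e * val e = val e. Proof. exact/eqP/(valP e). Qed.

Fact maxgroup_one_subproof : maxgroup_pred (val e).
Proof. by apply/asboolP; split=> //; exists (val e). Qed.

Let one : maxgroup := MaxGroup maxgroup_one_subproof.

Fact maxgroup_mul_subproof (a b : maxgroup) :
  maxgroup_pred (maxgroup_val a * maxgroup_val b).
Proof.
case: a => a aP; case: b => b bP /=.
have /asboolP[ea ae [a' [ea' a'e aa' a'a]]] := aP.
have /asboolP[eb be [b' [eb' b'e bb' b'b]]] := bP.
apply/asboolP; split; rewrite ?mulgA ?ea// -?mulgA ?be//.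
exists (b' * a'); split; rewrite ?mulgA ?eb'// -?mulgA ?a'e//.
  by rewrite (mulgA b) bb' ea' aa'.
by rewrite (mulgA a') a'a eb b'b.
Qed.

Let mul (a b : maxgroup) : maxgroup := MaxGroup (maxgroup_mul_subproof a b).

Fact maxgroup_inv_ex (a : maxgroup) :
  exists b : maxgroup, maxgroup_val a * maxgroup_val b = val e
    /\ maxgroup_val b * maxgroup_val a = val e.
Proof.
case: a => a aP; have /asboolP[ea ae [b [eb be ab ba]]] := aP.
have bP : maxgroup_pred b by apply/asboolP; split=> //; exists a.
by exists (MaxGroup bP).
Qed.

Let inv (a : maxgroup) : maxgroup := sval (cid (maxgroup_inv_ex a)).

Let mulA : associative mul.
Proof. by move=> a b c; apply: val_inj; rewrite /= mulgA. Qed.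
Let mul1 : left_id one mul.
Proof. by move=> [a aP]; apply: val_inj => /=; have /asboolP[] := aP. Qed.
Let mulx1 : right_id one mul.
Proof. by move=> [a aP]; apply: val_inj => /=; have /asboolP[] := aP. Qed.
Let mulV : left_inverse one inv mul.
Proof. by move=> a; apply: val_inj; rewrite /= /inv; case: cid => b /= []. Qed.
Let mulxV : right_inverse one inv mul.
Proof. by move=> a; apply: val_inj; rewrite /= /inv; case: cid => b /= []. Qed.

HB.instance Definition _ := isGroup.Build maxgroup mulA mul1 mulx1 mulV mulxV.

Lemma maxgroup_maximal (H : set S) : H (val e) ->
  (forall a b, H a -> H b -> H (a * b)) ->
  (forall a, H a -> val e * a = a /\ a * val e = a) ->
  (forall a, H a -> exists2 b, H b & a * b = val e /\ b * a = val e) ->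
  forall a, H a -> maxgroup_pred a.
Proof.
move=> He HM H1 HV a Ha; apply/asboolP; have [ea ae] := H1 _ Ha.
have [b Hb [ab ba]] := HV _ Ha; have [eb be] := H1 _ Hb.
by split=> //; exists b.
Qed.

End MaximalSubgroup.

Definition bounded_function (R : realType) (X : Type) (f : X -> R) : Prop :=
  exists M : R, forall x, `|f x| <= M.

(* Existence of a left-invariant mean m on the bounded functions; the values of
   m at unbounded functions are irrelevant. *)
Definition amenable (R : realType) (G : groupType) : Prop :=
  exists m : (G -> R) -> R,
    [/\ forall (a : R) f h, bounded_function f -> bounded_function h ->
          m (fun g => a * f g + h g) = a * m f + m h,
        forall f, bounded_function f -> (forall g, 0 <= f g) -> 0 <= m f,
        m (fun=> 1) = 1
      & forall f x, bounded_function f -> m (fun g => f (x * g)%g) = m f].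

(* Main.v *)
(* A bounded bimodule map sigma on l^1(S) is a uniformly bounded family of
   functionals m_s on l^oo(S x S) with m_{st}(F) = m_t(F(s -, -)) =
   m_s(F(-, - t)), and pi'' sigma = kappa reads
   m_s((x, w) |-> g(xw)) = g(s).  Write |x| for the idempotent of the maximal
   subgroup containing x; x |-> |x| is a homomorphism onto L.

   Biflat implies (i): if f <= e, applying both invariances with s = f to
   1[|x| = f] 1[|w| >= f] turns m_e of it into m_e of 1[|xw| >= f], which is 1.
   These sets are disjoint for distinct f, so at most ||sigma|| idempotents lie
   below e.  Biflat implies (ii): h |-> m_e(h(ex) 1[|x| >= e] 1[|w| >= e]) is a
   bounded left invariant functional on l^oo(G(e)) of total mass 1; its positive
   part, normalised, is a mean.

   Conversely, Moebius inversion gives central orthogonal idempotents rho_y in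
   l^1(S), of bounded norm, with delta_e the sum of the rho_y for y <= e.  An
   invariant mean on G(y) gives the virtual diagonal
   D_y(g) = mean_x (x (x) x^-1 g), and sigma(g) is the sum over y <= |g| of
   rho_y . D_y(g) . rho_y. *)
Require Import Defs.
From mathcomp Require Import all_boot all_order all_algebra finmap.
From mathcomp Require Import boolp classical_sets functions fsbigop cardinality.
From mathcomp Require Import reals ereal topology normedtype esum.
From mathcomp Require Import complex lra.

Set Implicit Arguments.
Unset Strict Implicit.
Unset Printing Implicit Defensive.

Import Order.TTheory GRing.Theory Num.Theory.
Import numFieldNormedType.Exports.

Local Open Scope classical_set_scope.
Local Open Scope ring_scope.
Local Open Scope complex_scope.

(** * Functionals and operators on l^1 *)

Lemma blinD {R : realType} (V W : normedModType (Cx R)) (F : blin V W) x y :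
  F (x + y) = F x + F y.
Proof. exact: linearD. Qed.

Lemma blinZ {R : realType} (V W : normedModType (Cx R)) (F : blin V W) k x :
  F (k *: x) = k *: F x.
Proof. exact: linearZ. Qed.

Lemma blin0 {R : realType} (V W : normedModType (Cx R)) (F : blin V W) : F 0 = 0.
Proof. exact: linear0. Qed.

Lemma blin_sum {R : realType} (V W : normedModType (Cx R)) (F : blin V W)
    (I : Type) (r : seq I) (P : pred I) (E : I -> V) :
  F (\sum_(i <- r | P i) E i) = \sum_(i <- r | P i) F (E i).
Proof. exact: linear_sum. Qed.

Section Ell1Duality.
Context {R : realType} {T : choiceType}.
Implicit Types (f g : ell1 R T) (c : T -> Cx R).

Lemma pairing_csummable f c (M : R) : (forall t, rnorm (c t) <= M) ->
  csummable setT (fun t => f t * c t).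
Proof.
move=> cM; apply: (psummable_le _ (psummableZ (a := fun t => rnorm (f t))
  (k := `|M|) (fun=> rnorm_ge0 _) (normr_ge0 M) (ell1_summable f))) => t.
rewrite rnormM mulrC ler_wpM2r ?rnorm_ge0//.
exact: le_trans (cM t) (ler_norm M).
Qed.

Definition pair_sum c f : Cx R := csum setT (fun t => f t * c t).

Lemma pair_sum_linear c (M : R) : (forall t, rnorm (c t) <= M) ->
  linear (pair_sum c).
Proof.
move=> cM k f g; rewrite /pair_sum -csum_linear; do ?exact: pairing_csummable cM.
congr csum; apply/funext => t.
by rewrite [X in X * _ = _](_ : _ = k * f t + g t)// mulrDl mulrA.
Qed.

Lemma pair_sumDr c c' (k : Cx R) (M : R) f : (forall t, rnorm (c t) <= M) ->
  (forall t, rnorm (c' t) <= M) ->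
  pair_sum (fun t => k * c t + c' t) f = k * pair_sum c f + pair_sum c' f.
Proof.
move=> cM cM'; rewrite /pair_sum -csum_linear; last 2 first.
- exact: pairing_csummable cM.
- exact: pairing_csummable cM'.
by congr csum; apply/funext => t; rewrite mulrDr mulrCA.
Qed.

Lemma pair_sum_bound c (M : R) f : (forall t, rnorm (c t) <= M) ->
  rnorm (pair_sum c f) <= M * rnorm f.
Proof.
(* The sign of [M] is not assumed: if [T] is empty, [M] may be negative. A nonzero coordinate of [f]
   forces [0 <= M], hence the separate case [f = 0]. *)
move=> cM; have [/eqP f0|f0] := boolP (f == 0).
  rewrite f0 rnorm0 mulr0 /pair_sum (le_trans (csum_bound _))//.
    exact: pairing_csummable cM.
  rewrite /psum esum1// => t _.
  by rewrite [X in rnorm X](_ : _ = 0) ?rnorm0//; exact: mul0r.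
have M0 : 0 <= M.
  have [t _] : exists t, f t != 0.
    apply: contrapT => /forallNP fn; move/eqP : f0; apply.
    by apply: ell1P => t; apply/eqP; move: (fn t) => /negP; rewrite negbK.
  exact: le_trans (rnorm_ge0 (c t)) (cM t).
rewrite (le_trans (csum_bound (pairing_csummable f cM)))//.
rewrite ell1_rnormE /ell1_norm -/(psum _ _) -psumZ//; last 2 first.
- by move=> t; exact: rnorm_ge0.
- exact: ell1_summable.
apply: psum_le => [t|t|]; first exact: rnorm_ge0.
  by rewrite rnormM mulrC ler_wpM2r ?rnorm_ge0.
by apply: psummableZ => //; [move=> t; exact: rnorm_ge0|exact: ell1_summable].
Qed.

Definition pairing c (M : R) (cM : forall t, rnorm (c t) <= M) :
  dual (ell1 R T) :=
  mk_blin (pair_sum_linear cM) (fun f => pair_sum_bound f cM).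

Lemma csummable0 (I : choiceType) (D : set I) : csummable D (fun=> 0 : Cx R).
Proof.
rewrite /csummable /psummable esum1 ?ltry// => i _.
by rewrite rnorm0.
Qed.

Lemma csum0 (I : choiceType) (D : set I) : csum D (fun=> 0 : Cx R) = 0.
Proof.
have := csum_linear 1 (csummable0 D) (csummable0 D).
rewrite !mul1r addr0 => /eqP.
by rewrite -subr_eq subrr eq_sym => /eqP.
Qed.

Lemma pair_sum_delta c t : pair_sum c (delta t) = c t.
Proof.
rewrite /pair_sum.
have -> : (fun s => (delta t : ell1 R T) s * c s) =
    (fun s => c t * (if s == t then 1 else 0) + 0).
  apply/funext => s; rewrite addr0 /=.
  by case: eqP => [->|_]; rewrite ?mul1r ?mulr1 ?mul0r ?mulr0.
rewrite csum_linear.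
- by rewrite csum_delta in_setT mulr1 csum0 addr0.
- exact: (ell1_summable (delta t)).
- exact: csummable0.
Qed.

(** The kernel of [F - G] is a closed subspace containing the basis, whose span is dense. Identities
    between bounded operators on l^1 are reduced to basis elements in this way throughout. *)
Lemma blin_dense (V : normedModType (Cx R)) (F G : blin (ell1 R T) V) :
  (forall t, F (delta t) = G (delta t)) -> F = G.
Proof.
move=> FG; apply/eqP; rewrite -subr_eq0; apply/eqP; set H := F - G.
apply: blinP => f; rewrite [RHS](_ : _ = 0)//.
apply: (@ell1_dense _ _ (fun f => H f = 0)) => [|t|k f1 f2 h1 h2|f1 h1].
- exact: linear0.
- by rewrite [LHS](_ : _ = F (delta t) - G (delta t))// FG subrr.
- by rewrite (blin_linear H) h1 h2 scaler0 addr0.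
apply: rnorm_eq0; apply/le_anti; rewrite rnorm_ge0 andbT.
apply/ler_addgt0Pl => e e0; rewrite addr0.
have d0 : 0 < opnorm H + 1 by rewrite ltr_wpDl ?opnorm_ge0.
have [g Hg fg] := h1 _ (divr_gt0 e0 d0).
rewrite -[f1](subrK g) blinD Hg addr0 (le_trans (opnormP H _))//.
rewrite mulrC; move: fg; rewrite ltr_pdivlMr// => /ltW; apply: le_trans.
by rewrite ler_wpM2l ?rnorm_ge0// lerDl.
Qed.

Lemma delta_norm (t : T) : rnorm (delta t : ell1 R T) = 1.
Proof.
rewrite ell1_rnormE /ell1_norm delta_esum in_setT /rnorm.
by rewrite normr1.
Qed.

End Ell1Duality.

(** * Extension of a bounded family to an operator on l^1 *)

Section Ell1Lift.
Context {R : realType} {T : choiceType} {Y : completeNormedModType (Cx R)}.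
Variables (c : T -> Y) (M : R).
Hypotheses (M0 : 0 <= M) (cM : forall t, rnorm (c t) <= M).

Let S (f : ell1 R T) (Z : {fset T}) : Y := \sum_(t <- Z) f t *: c t.
Let a (f : ell1 R T) (Z : {fset T}) : R := \sum_(t <- Z) rnorm (f t).

Let a_le f Z : a f Z <= rnorm f.
Proof.
rewrite ell1_rnormE -lee_fin ell1_normK; apply: esum_ge; exists [set` Z] => //.
rewrite fsumEFin; last exact: finite_fset.
by rewrite fsbig_finite ?set_fsetK//; exact: finite_fset.
Qed.

Let S_bound f Z : rnorm (S f Z) <= M * a f Z.
Proof.
rewrite /S /a mulr_sumr; elim/big_ind2 : _ => [|x1 x2 y1 y2 h1 h2|t _].
- by rewrite rnorm0.
- by rewrite (le_trans (rnormD _ _))// lerD.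
- by rewrite rnormZ mulrC ler_wpM2r ?rnorm_ge0.
Qed.

(** Choose [X] carrying all but [e / (M + 1)] of the norm of [f]; the terms outside [X] then
    contribute less than [e]. The [+ 1] guards against [M = 0]. *)
Let S_cauchy f (e : R) : 0 < e -> exists X : {fset T},
  forall Z : {fset T}, (X `<=` Z)%fset -> rnorm (S f X - S f Z) < e.
Proof.
move=> e0; have M1 : 0 < M + 1 by rewrite ltr_wpDl.
have d0 := divr_gt0 e0 M1; set d := e / _ in d0.
have : ((ell1_norm f - d)%:E < (ell1_norm f)%:E)%E by rewrite lte_fin; lra.
rewrite [ltRHS]ell1_normK => /ereal_sup_gt[_ [X [finX _] <-]].
rewrite fsumEFin// lte_fin fsbig_finite//=; set X' := fset_set X => fX.
exists X' => Z XZ.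
have split (V : zmodType) (E : T -> V) : \sum_(t <- Z) E t =
    \sum_(t <- X') E t + \sum_(t <- (Z `\` X')%fset) E t.
  rewrite (big_fsetID _ (fun t => t \in X'))/=; congr (_ + _).
    by apply: eq_fbigl => t; rewrite !inE/= andb_idl//; exact: (fsubsetP XZ).
  by apply: eq_fbigl => t; rewrite !inE/= andbC.
have -> : S f X' - S f Z = - S f (Z `\` X')%fset.
  by rewrite /S (split _ (fun t => f t *: c t)) opprD addrA subrr sub0r.
rewrite rnormN (le_lt_trans (S_bound _ _))//.
have aZ : a f (Z `\` X')%fset < d.
  have := a_le f Z; rewrite /a split ell1_rnormE => h.
  by move: fX h; rewrite /a; lra.
have a0 : 0 <= a f (Z `\` X')%fset.
  by apply: sumr_ge0 => t _; exact: rnorm_ge0.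
move: aZ; rewrite /d ltr_pdivlMr// mulrDr mulr1 mulrC; apply: le_lt_trans.
by rewrite lerDl.
Qed.

(** Unordered summation: convergence along the finite subsets of [T] directed by inclusion, as [T]
    carries no enumeration. *)
Let is_sum f (y : Y) := forall e : R, 0 < e -> exists X : {fset T},
  forall Z : {fset T}, (X `<=` Z)%fset -> rnorm (y - S f Z) < e.

Let sum_ex f : exists y, is_sum f y.
Proof.
(* The filter of sets that contain all partial sums from some finite set on; [S_cauchy] makes it
   Cauchy, and completeness of [Y] gives the sum. *)
pose F : set_system Y := [set A : set Y | exists X : {fset T},
  forall Z : {fset T}, (X `<=` Z)%fset -> A (S f Z)].
have FF : ProperFilter F.
  split.
    by move=> [X /(_ X)]; apply.
  split=> [|A B [X XA] [X' XB]|A B AB [X XA]].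
  - by exists fset0%fset.
  - exists (X `|` X')%fset => Z; rewrite fsubUset => /andP[XZ X'Z].
    by split; [exact: XA|exact: XB].
  - by exists X => Z /XA /AB.
have Fc : cauchy F.
  apply/cauchyP => e e0.
  have eE : e = (complex.Re e)%:C by rewrite RRe_real// gtr0_real.
  move: e0; rewrite eE ltcR => e0.
  have [X XP] := S_cauchy f e0; exists (S f X), X => Z XZ.
  by rewrite -ball_normE /ball_/= -rnormE ltcR XP.
have [y Fy] := (cvg_ex F).1 (cauchy_cvg F Fc).
exists y => e e0; have e0' : 0 < (e%:C : Cx R) by rewrite ltcR.
have {}Fy : id @ F --> y by [].
have /cvgrPdist_lt/(_ _ e0')[X XP] := Fy.
by exists X => Z /XP/=; rewrite -rnormE ltcR.
Qed.

Let is_sum_uniq f y y' : is_sum f y -> is_sum f y' -> y = y'.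
Proof.
move=> fy fy'; apply/eqP; rewrite -subr_eq0; apply/eqP; apply: rnorm_eq0.
apply/le_anti; rewrite rnorm_ge0 andbT; apply/ler_addgt0Pl => e e0; rewrite addr0.
have e20 : 0 < e / 2 by lra.
have [X XP] := fy _ e20; have [X' XP'] := fy' _ e20.
have := XP (X `|` X')%fset (fsubsetUl _ _); have := XP' (X `|` X')%fset (fsubsetUr _ _).
set s := S f (X `|` X')%fset => h' h; rewrite (_ : y - y' = (y - s) - (y' - s)).
  by rewrite (le_trans (rnormD _ _))// rnormN; lra.
by rewrite opprB addrA subrK.
Qed.

Let L f : Y := sval (cid (sum_ex f)).
Let LP f : is_sum f (L f). Proof. by rewrite /L; case: cid. Qed.

Let L_linear : linear L.
Proof.
move=> k f g; apply: (is_sum_uniq (LP _)) => e e0.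
have k1 : 0 < rnorm k + 1 by rewrite ltr_wpDl ?rnorm_ge0.
have e20 : 0 < e / 2 by lra.
have [X XP] := LP f (divr_gt0 e20 k1); have [X' XP'] := LP g e20.
exists (X `|` X')%fset => Z; rewrite fsubUset => /andP[/XP h /XP' h'].
have -> : S (k *: f + g) Z = k *: S f Z + S g Z.
  rewrite /S scaler_sumr -big_split/=; apply: eq_bigr => t _.
  by rewrite [X in X *: _ = _](_ : _ = k * f t + g t)// scalerDl scalerA.
rewrite opprD addrACA -scalerBr (le_lt_trans (rnormD _ _))// rnormZ.
move: h; rewrite ltr_pdivlMr// => h.
have : rnorm k * rnorm (L f - S f Z) <= rnorm (L f - S f Z) * (rnorm k + 1).
  by rewrite mulrC ler_wpM2l ?rnorm_ge0// lerDl.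
by lra.
Qed.

Let L_bound f : rnorm (L f) <= M * rnorm f.
Proof.
apply/ler_addgt0Pr => e /(LP f)[X /(_ X (fsubset_refl _)) h].
rewrite -(subrK (S f X) (L f)) addrC (le_trans (rnormD _ _))// lerD//; last exact: ltW.
by rewrite (le_trans (S_bound _ _))// ler_wpM2l.
Qed.

Lemma ell1_lift : exists F : blin (ell1 R T) Y,
  (forall t, F (delta t) = c t) /\ opnorm F <= M.
Proof.
exists (mk_blin L_linear L_bound); split; last exact: opnorm_mk_blin.
move=> t; apply: (is_sum_uniq (LP _)) => e e0; exists [fset t]%fset => Z tZ.
suff -> : S (delta t) Z = c t by rewrite subrr rnorm0.
rewrite /S (big_fsetD1 t)/=; last by apply: (fsubsetP tZ); rewrite inE.
rewrite eqxx scale1r big_seq big1 ?addr0// => s; rewrite !inE => /andP[/negPf -> _].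
by rewrite scale0r.
Qed.

End Ell1Lift.

(** * l^1(S x S) as projective tensor square of l^1(S) *)

Section Ell1Tensor.
Context {R : realType} {S : semigroupType}.
Notation A := (conv_alg R S).
Implicit Types f g : A.

Fact ell1_tens_subproof f g :
  (fun p : S * S => f p.1 * g p.2) \in ell1_pred R (S * S)%type.
Proof. by apply/asboolP; rewrite esum_prod ltry. Qed.

Definition ell1_tens f g : ell1 R (S * S)%type := Ell1 (ell1_tens_subproof f g).

Fact ell1_tens_bilinear : bounded_bilinear ell1_tens 1.
Proof.
split=> [g k f f'|f k g g'|f g].
- apply: ell1P => p; rewrite [LHS](_ : _ = (k * f p.1 + f' p.1) * g p.2)//.
  by rewrite mulrDl -mulrA.
- apply: ell1P => p; rewrite [LHS](_ : _ = f p.1 * (k * g p.2 + g' p.2))//.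
  by rewrite mulrDr mulrCA.
- by rewrite mul1r !ell1_rnormE /ell1_norm esum_prod.
Qed.

Lemma ell1_tens_delta s t : ell1_tens (delta s) (delta t) = delta (s, t).
Proof.
apply: ell1P => -[x y] /=; rewrite xpair_eqE.
by do 2!case: eqP => _ /=; rewrite ?mulr1 ?mulr0.
Qed.

Fact ell1_tens_universal (Y : completeNormedModType (Cx R))
    (beta : A -> A -> Y) (M : R) : 0 <= M -> bounded_bilinear beta M ->
  exists F : blin (ell1 R (S * S)%type) Y,
    [/\ forall a b, F (ell1_tens a b) = beta a b, opnorm F <= M
      & forall G : blin (ell1 R (S * S)%type) Y,
          (forall a b, G (ell1_tens a b) = beta a b) -> G = F].
Proof.
move=> M0 [bl br bM].
have cM (p : S * S) : rnorm (beta (delta p.1) (delta p.2)) <= M.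
  by rewrite (le_trans (bM _ _))// !delta_norm !mulr1.
have [F [Fd FM]] := ell1_lift M0 cM.
have [tl tr tM] := ell1_tens_bilinear.
exists F; split=> // [f g|G GE].
  have blM1 b x : rnorm (beta x b) <= M * rnorm b * rnorm x.
    by rewrite -mulrA (mulrC (rnorm b)).
  have blM2 x b : rnorm (beta x b) <= M * rnorm x * rnorm b.
    by rewrite -mulrA.
  have tM1 b x : rnorm (ell1_tens x b) <= rnorm b * rnorm x.
    by rewrite mulrC (le_trans (tM _ _))// mul1r.
  have tM2 x b : rnorm (ell1_tens x b) <= rnorm x * rnorm b.
    by rewrite (le_trans (tM _ _))// mul1r.
  (* Density is used one variable at a time: first in the second factor with a basis element in the
     first, then in the first factor. *)
  have step s : blin_comp F (mk_blin (tr (delta s)) (tM2 (delta s))) =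
      mk_blin (br (delta s)) (blM2 (delta s)).
    by apply: blin_dense => t /=; rewrite ell1_tens_delta Fd.
  suff /(congr1 (fun H : blin _ _ => H f)) :
    blin_comp F (mk_blin (tl g) (tM1 g)) = mk_blin (bl g) (blM1 g) by [].
  apply: blin_dense => s.
  exact: (congr1 (fun H : blin _ _ => H g) (step s)).
apply: blin_dense => -[s t]; rewrite -ell1_tens_delta GE ell1_tens_delta.
by rewrite Fd.
Qed.

Definition ell1_proj_tensor : proj_tensor A A :=
  ProjTensor ell1_tens_bilinear ell1_tens_universal.

End Ell1Tensor.

(** * Clifford semigroups *)

Section CliffordSupport.
Context {S : semigroupType} (HS : clifford_semigroup S).
Local Open Scope group_scope.
Implicit Types (a b s : S) (e f y : idem S).

Definition cinv a : S := sval (cid (HS.1 a)).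

Lemma cinvP a : a * cinv a * a = a /\ cinv a * a * cinv a = cinv a.
Proof. by rewrite /cinv; case: cid => b /= []. Qed.

Lemma cinv_uniq a b : a * b * a = a -> b * a * b = b -> cinv a = b.
Proof. by move=> h1 h2; rewrite /cinv; case: cid => c /= [_]; apply. Qed.

Fact supp_subproof a : exists e : idem S, val e = a * cinv a.
Proof.
have aa : a * cinv a * (a * cinv a) == a * cinv a.
  by apply/eqP; rewrite mulgA (cinvP a).1.
by exists (exist (fun x : S => x * x == x) _ aa).
Qed.

(** The idempotent written |a| in the outline above: the identity of the maximal subgroup containing
    [a]. *)
Definition supp a : idem S := sval (cid (supp_subproof a)).

Lemma suppE a : val (supp a) = a * cinv a.
Proof. by rewrite /supp; case: cid. Qed.

Lemma idem_mulgg e : val e * val e = val e.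
Proof. exact/eqP/(valP e). Qed.

Lemma idem_central e a : val e * a = a * val e.
Proof. exact/HS.2/idem_mulgg. Qed.

Lemma mul_supp a : val (supp a) * a = a.
Proof. by rewrite suppE (cinvP a).1. Qed.

(** The hypotheses make [b] a generalised inverse of [a], so [b] is [cinv a] by uniqueness. This is
    the tool for computing supports. *)
Lemma supp_unique a b e : val e * a = a -> val e * b = b ->
  a * b = val e -> b * a = val e -> supp a = e.
Proof.
move=> ea eb ab ba; apply: val_inj; rewrite suppE.
suff -> : cinv a = b by [].
by apply: cinv_uniq; rewrite ?ab ?ba.
Qed.

(** Both products of [a] with its inverse are central idempotents, and each absorbs the other. *)
Lemma mulV_supp a : cinv a * a = val (supp a).
Proof.
have ff : cinv a * a * (cinv a * a) = cinv a * a by rewrite mulgA (cinvP a).2.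
have fe : cinv a * a * val (supp a) = cinv a * a.
  by rewrite -mulgA -idem_central mul_supp.
by rewrite -fe suppE mulgA (HS.2 _ a ff) mulgA (cinvP a).1.
Qed.

(** Idempotents move past every factor, so [cinv b * cinv a] inverts [a * b] relative to the product
    of the two supports, and [supp_unique] applies once that product is known to be idempotent. *)
Lemma suppM a b : val (supp (a * b)) = val (supp a) * val (supp b).
Proof.
suff [e eE] : exists e : idem S, val e = val (supp a) * val (supp b).
  rewrite -eE; congr val.
  have sV c : val (supp c) * cinv c = cinv c.
    by rewrite -mulV_supp (cinvP c).2.
  apply: (@supp_unique _ (cinv b * cinv a)); rewrite eE.
  - rewrite -mulgA (mulgA _ a b) (idem_central (supp b) a) -mulgA mul_supp.
    by rewrite mulgA mul_supp.
  - rewrite (idem_central (supp a)) -mulgA (mulgA _ (cinv b)).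
    by rewrite (idem_central _ (cinv b)) -mulgA sV mulgA sV.
  - rewrite -mulgA (mulgA b) -suppE.
    by rewrite (idem_central (supp b)) mulgA -suppE.
  - rewrite -mulgA (mulgA (cinv a)) mulV_supp.
    rewrite (idem_central (supp a) b) (mulgA (cinv b)) mulV_supp.
    by rewrite (idem_central (supp a)).
suff ef : val (supp a) * val (supp b) * (val (supp a) * val (supp b)) ==
    val (supp a) * val (supp b).
  by exists (exist (fun x : S => x * x == x) _ ef).
apply/eqP; rewrite -mulgA (mulgA (val (supp b))).
by rewrite -(idem_central (supp a) (val (supp b))) -mulgA idem_mulgg mulgA idem_mulgg.
Qed.

Lemma supp_idem e : supp (val e) = e.
Proof. by apply: (@supp_unique _ (val e)); rewrite idem_mulgg. Qed.

Lemma supp_maxgroup e (x : maxgroup e) : supp (val x) = e.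
Proof.
have /asboolP[ex _ [b [eb _ xb bx]]] := valP x.
exact: supp_unique ex eb xb bx.
Qed.

(** Multiplication by [val e] is the structure map from the group at [supp s] to the group at [e] in
    the strong semilattice; the inverse of the image is [val e * cinv s]. *)
Lemma maxgroup_restrict e s : val e * val (supp s) = val e ->
  maxgroup_pred e (val e * s).
Proof.
move=> es; apply/asboolP; split.
- by rewrite mulgA idem_mulgg.
- by rewrite -mulgA -idem_central mulgA idem_mulgg.
exists (val e * cinv s); split.
- by rewrite mulgA idem_mulgg.
- by rewrite -mulgA -idem_central mulgA idem_mulgg.
- rewrite (idem_central e s) -mulgA (mulgA (val e)) idem_mulgg mulgA.
  by rewrite -(idem_central e s) -mulgA -suppE.
- rewrite (idem_central e (cinv s)) -mulgA (mulgA (val e)) idem_mulgg mulgA.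
  by rewrite -(idem_central e (cinv s)) -mulgA mulV_supp.
Qed.

End CliffordSupport.

(** * Means from bounded invariant functionals *)

Section PositivePart.
Context {R : realType} {G : groupType}.
Variables (N : (G -> R) -> R) (C : R).
Hypothesis N_lin : forall (a : R) f h, bounded_function f -> bounded_function h ->
  N (fun g => a * f g + h g) = a * N f + N h.
Hypothesis N_bound : forall f (K : R), (forall g, `|f g| <= K) -> `|N f| <= C * K.
Hypothesis N1 : N (fun=> 1) = 1.
Hypothesis N_inv : forall f x, bounded_function f ->
  N (fun g => f (x * g)%g) = N f.
Implicit Types f h u v : G -> R.

Let pos f := bounded_function f /\ forall g, 0 <= f g.

Let interval f : set R := [set N u | u in [set u | forall g, 0 <= u g <= f g]].

(** The positive part of [N] in the Riesz sense, on nonnegative bounded functions: the supremum of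
    [N] over the order interval from 0 to [f]. *)
Let P f := sup (interval f).

Let below_bounded f u : pos f -> (forall g, 0 <= u g <= f g) -> bounded_function u.
Proof.
move=> [[K fK] _] uf; exists K => g; have /andP[u0 ufg] := uf g.
by rewrite ger0_norm// (le_trans ufg)// (le_trans (ler_norm _)).
Qed.

Let bounded_cst (k : R) : bounded_function (fun _ : G => k).
Proof. by exists `|k|. Qed.

Let bounded_lin (a : R) f h : bounded_function f -> bounded_function h ->
  bounded_function (fun g => a * f g + h g).
Proof.
move=> [K fK] [K' hK]; exists (`|a| * K + K') => g.
by rewrite (le_trans (ler_normD _ _))// lerD// normrM ler_wpM2l.
Qed.

Let N0 : N (fun=> 0) = 0.
Proof.
have := N_lin (-1) (bounded_cst 0) (bounded_cst 0).
rewrite (_ : (fun _ => _) = (fun=> 0)); first by lra.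
by apply/funext => g; rewrite mulr0 addr0.
Qed.

Let ND f h : bounded_function f -> bounded_function h ->
  N (fun g => f g + h g) = N f + N h.
Proof.
move=> bf bh; rewrite -[N f]mul1r -N_lin//; congr N; apply/funext => g.
by rewrite mul1r.
Qed.

Let NZ (a : R) f : bounded_function f -> N (fun g => a * f g) = a * N f.
Proof.
move=> bf; rewrite -[RHS]addr0 -[in RHS]N0 -N_lin//; congr N; apply/funext => g.
by rewrite addr0.
Qed.

Let P_has_sup f : pos f -> has_sup (interval f).
Proof.
move=> [[K fK] f0]; split.
  by exists (N (fun=> 0)), (fun=> 0) => //= g; rewrite lexx f0.
exists (C * K) => _ [u /= uf <-]; rewrite (le_trans (ler_norm _))//.
apply: N_bound => g; have /andP[u0 ufg] := uf g.
by rewrite ger0_norm// (le_trans ufg)// (le_trans (ler_norm _)).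
Qed.

Let P_ub f u : pos f -> (forall g, 0 <= u g <= f g) -> N u <= P f.
Proof.
by move=> pf uf; apply: (sup_upper_bound (P_has_sup pf)); exists u.
Qed.

Let P_le f (z : R) : pos f ->
  (forall u, (forall g, 0 <= u g <= f g) -> N u <= z) -> P f <= z.
Proof.
move=> pf uz; apply: ge_sup; first by have [] := P_has_sup pf.
by move=> _ [u /= uf <-]; exact: uz.
Qed.

Let P_ge0 f : pos f -> 0 <= P f.
Proof.
move=> pf; rewrite -N0; apply: P_ub => // g; rewrite lexx; exact: pf.2.
Qed.

Let pos_lin (a : R) f h : 0 <= a -> pos f -> pos h -> pos (fun g => a * f g + h g).
Proof.
move=> a0 [bf f0] [bh h0]; split; first exact: bounded_lin.
by move=> g; rewrite addr_ge0// mulr_ge0.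
Qed.

Let posD f h : pos f -> pos h -> pos (fun g => f g + h g).
Proof.
move=> pf ph; have := pos_lin ler01 pf ph.
rewrite (_ : (fun _ => _) = (fun g => f g + h g))//.
by apply/funext => g; rewrite mul1r.
Qed.

Let pos_cst (k : R) : 0 <= k -> pos (fun=> k).
Proof. by split. Qed.

Let posZ (a : R) f : 0 <= a -> pos f -> pos (fun g => a * f g).
Proof.
move=> a0 pf; have := pos_lin a0 pf (pos_cst (lexx 0)).
by rewrite (_ : (fun _ => _) = (fun g => a * f g))//; apply/funext => g; rewrite addr0.
Qed.

(* Riesz decomposition: 0 <= u <= f + h splits as min(u, f) + (u - min(u, f)). *)
Let PD f h : pos f -> pos h -> P (fun g => f g + h g) = P f + P h.
Proof.
move=> pf ph; have pfh := posD pf ph; apply/le_anti/andP; split.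
  apply: P_le => // u uf; pose u1 g := Num.min (u g) (f g).
  have u1P g : 0 <= u1 g <= f g.
    by rewrite /u1 le_min ge_min lexx orbT andbT pf.2 andbT; case/andP : (uf g).
  have u2P g : 0 <= u g - u1 g <= h g.
    have /andP[u0 ub] := uf g; have := ph.2 g.
    by rewrite /u1 minEle; case: ifPn; rewrite -?ltNge => *; apply/andP; split; lra.
  have -> : N u = N u1 + N (fun g => u g - u1 g).
    rewrite -ND; [|exact: below_bounded pf u1P|exact: below_bounded ph u2P].
    by congr N; apply/funext => g; rewrite addrC subrK.
  by rewrite lerD// P_ub.
rewrite -lerBrDr; apply: P_le => // u uf; rewrite lerBrDr addrC -lerBrDr.
apply: P_le => // v vh; rewrite lerBrDr addrC -ND; last 2 first.
- exact: below_bounded pf uf.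
- exact: below_bounded ph vh.
apply: P_ub => // g; have /andP[u0 u1] := uf g; have /andP[v0 v1] := vh g.
by rewrite addr_ge0//= lerD.
Qed.

Let PZ_le (a : R) f : 0 < a -> pos f -> P (fun g => a * f g) <= a * P f.
Proof.
move=> a0 pf; apply: P_le => [|u uf]; first exact: posZ (ltW a0) pf.
rewrite -ler_pdivrMl// -NZ; last exact: below_bounded (posZ (ltW a0) pf) uf.
apply: P_ub => // g; have /andP[u0 u1] := uf g.
by rewrite mulr_ge0 ?invr_ge0 ?(ltW a0)//= ler_pdivrMl.
Qed.

Let PZ (a : R) f : 0 <= a -> pos f -> P (fun g => a * f g) = a * P f.
Proof.
rewrite le_eqVlt => /predU1P[<- pf|a0 pf].
  rewrite mul0r (_ : (fun g => 0 * f g) = (fun=> 0)); last first.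
    by apply/funext => g; rewrite mul0r.
  apply/le_anti; rewrite P_ge0 ?andbT; last exact: pos_cst.
  apply: P_le => [|u u0]; first exact: pos_cst.
  rewrite (_ : u = fun=> 0) ?N0//; apply/funext => g; apply/le_anti.
  by rewrite andbC u0.
(* The reverse inequality is [PZ_le] for the scalar [a^-1] and the function [a * f]. *)
apply/le_anti; rewrite PZ_le//=.
rewrite -ler_pdivlMl//.
have aV0 : 0 < a^-1 by rewrite invr_gt0.
apply: le_trans (PZ_le aV0 (posZ (ltW a0) pf)).
rewrite le_eqVlt; apply/orP; left; apply/eqP; congr P; apply/funext => g.
by rewrite mulKf// gt_eqF.
Qed.

Let pos_trans f x : pos f -> pos (fun g => f (x * g)%g).
Proof. by move=> [[K fK] f0]; split=> //; exists K. Qed.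

(** Translating by [x^-1] carries the order interval of the translate of [f] into that of [f] and
    does not change [N]. *)
Let P_inv_le f x : pos f -> P (fun g => f (x * g)%g) <= P f.
Proof.
move=> pf; apply: P_le => [|u uf]; first exact: pos_trans.
rewrite -(N_inv x^-1%g); last exact: below_bounded (pos_trans x pf) uf.
by apply: P_ub => // g; have := uf (x^-1 * g)%g; rewrite mulVKg.
Qed.

Let P_inv f x : pos f -> P (fun g => f (x * g)%g) = P f.
Proof.
move=> pf; apply/le_anti; rewrite P_inv_le//=.
have := P_inv_le x^-1%g (pos_trans x pf).
rewrite (_ : (fun g => f (x * (x^-1 * g))%g) = f)//.
by apply/funext => g; rewrite mulVKg.
Qed.

Let pp f g := Num.max (f g) 0.
Let pn f g := Num.max (- f g) 0.

Let pp_pos f : bounded_function f -> pos (pp f).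
Proof.
move=> [K fK]; split; last by move=> g; rewrite le_max lexx orbT.
exists K => g; rewrite (le_trans _ (fK g))// /pp maxEle.
by case: ifP => _; rewrite ?normr0.
Qed.

Let pn_pos f : bounded_function f -> pos (pn f).
Proof.
move=> [K fK]; split; last by move=> g; rewrite le_max lexx orbT.
exists K => g; rewrite (le_trans _ (fK g))// /pn maxEle.
by case: ifP => _; rewrite ?normr0// normrN.
Qed.

Let Q f := P (pp f) - P (pn f).

(** The value does not depend on how [f] is written as a difference of positive functions:
    [pp f + v = u + pn f], and [P] is additive. *)
Let QE f u v : pos u -> pos v -> (forall g, f g = u g - v g) -> Q f = P u - P v.
Proof.
move=> pu pv fE; have bf : bounded_function f.
  have := bounded_lin (-1) pv.1 pu.1.
  by rewrite (_ : (fun _ => _) = f)//; apply/funext => g; rewrite fE mulN1r addrC.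
have [p1 p2] := (pp_pos bf, pn_pos bf).
suff : P (pp f) + P v = P u + P (pn f) by rewrite /Q; lra.
rewrite -!PD//; congr P; apply/funext => g.
have := fE g; rewrite /pp /pn !maxEle.
by case: ifP; case: ifP; lra.
Qed.

Let ppn f g : f g = pp f g - pn f g.
Proof. by rewrite /pp /pn !maxEle; case: ifP; case: ifP; lra. Qed.

Let Q_lin (a : R) f h : bounded_function f -> bounded_function h ->
  Q (fun g => a * f g + h g) = a * Q f + Q h.
Proof.
move=> bf bh; have [[p1 n1] [p2 n2]] :=
  ((pp_pos bf, pn_pos bf), (pp_pos bh, pn_pos bh)).
have [a0|/ltW a0] := leP 0 a.
  rewrite (@QE _ (fun g => a * pp f g + pp h g) (fun g => a * pn f g + pn h g)).
  - rewrite !PD//; do ?exact: posZ.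
    by rewrite !PZ// /Q; lra.
  - exact: pos_lin.
  - exact: pos_lin.
  - by move=> g; rewrite {1}(ppn f g) {1}(ppn h g); lra.
have a0' : 0 <= - a by rewrite oppr_ge0.
rewrite (@QE _ (fun g => (- a) * pn f g + pp h g) (fun g => (- a) * pp f g + pn h g)).
- rewrite !PD//; do ?exact: posZ.
  by rewrite !PZ// /Q; lra.
- exact: pos_lin.
- exact: pos_lin.
- by move=> g; rewrite {1}(ppn f g) {1}(ppn h g); lra.
Qed.

Let Q_pos f : pos f -> Q f = P f.
Proof.
move=> pf; rewrite (QE pf (pos_cst (lexx 0))); last by move=> g; rewrite subr0.
have := PZ (lexx 0) pf; rewrite mul0r (_ : (fun g => 0 * f g) = (fun=> 0)).
  by move=> ->; rewrite subr0.
by apply/funext => g; rewrite mul0r.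
Qed.

(** The constant 1 lies in its own order interval, so [P 1 >= N 1 = 1] and the positive part can be
    normalised to a mean. *)
Lemma amenable_of_bounded_invariant : amenable R G.
Proof.
have p1 : pos (fun=> 1) by exact: pos_cst.
have P1 : 0 < P (fun=> 1).
  by rewrite (lt_le_trans ltr01)// -{1}N1 P_ub// => g; rewrite ler01 lexx.
exists (fun f => Q f / P (fun=> 1)); split.
- by move=> a f h bf bh; rewrite Q_lin// mulrDl mulrA.
- by move=> f bf f0; rewrite divr_ge0 ?(ltW P1)// Q_pos// P_ge0.
- by rewrite Q_pos// divff// gt_eqF.
- move=> f x bf; congr (_ / _); rewrite /Q -(P_inv x (pp_pos bf)).
  by rewrite -(P_inv x (pn_pos bf)).
Qed.

End PositivePart.

(** * Consequences of biflatness *)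

Section VirtualDiagonal.
Context {R : realType} {S : semigroupType}.
Local Notation A := (conv_alg R S).

Let bfun (f : S * S -> R) := bounded_function f.

(* The real part of sigma (delta s), read as a finitely additive measure on
   S * S: the integral of a bounded real function f against it. *)
Lemma biflat_virtual_diagonal : biflat A ->
  exists (m : S -> (S * S -> R) -> R) (C : R),
  [/\ forall s (a : R) f h, bfun f -> bfun h ->
        m s (fun p => a * f p + h p) = a * m s f + m s h,
      forall s f (K : R), (forall p, `|f p| <= K) -> `|m s f| <= C * K,
      forall s t f, bfun f -> m (s * t)%g f = m t (fun p => f (s * p.1, p.2)%g),
      forall s t f, bfun f -> m (s * t)%g f = m s (fun p => f (p.1, p.2 * t)%g)
    & forall s (f : S -> R), bounded_function f ->
        m s (fun p => f (p.1 * p.2)%g) = f s].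
Proof.
(* In the model l^1(S x S) every bounded function on [S * S] is a functional on the tensor
   square. *)
pose Q : proj_tensor A A := ell1_proj_tensor.
move=> [P /(@biflat_with_indep _ _ _ Q)[sigma [sl sr sp]]].
pose cplx (T : Type) (f : T -> R) t : Cx R := (f t)%:C.
have cplx_le (T : Type) (f : T -> R) (K : R) : (forall t, `|f t| <= K) ->
    forall t, rnorm (cplx T f t) <= K.
  by move=> fK t; rewrite rnorm_real.
(* The functional induced by [f], with default value 0 when [f] is unbounded. *)
pose phi (T : choiceType) (f : T -> R) : dual (ell1 R T) :=
  if pselect (bounded_function f) is left bf
  then pairing (cplx_le _ _ _ (svalP (cid bf))) else 0.
have phiE (T : choiceType) (f : T -> R) g : bounded_function f ->
    phi T f g = pair_sum (cplx T f) g.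
  by move=> bf; rewrite /phi; case: pselect.
have phid (T : choiceType) (f : T -> R) t : bounded_function f ->
    phi T f (delta t) = (f t)%:C.
  by move=> bf; rewrite phiE// pair_sum_delta.
have sd (s t : S) : bamul (delta s : A) (delta t) = delta (s * t)%g.
  exact: conv_delta.
pose m s f := complex.Re (sigma (delta s) (phi (S * S)%type f)).
exists m, (opnorm sigma); split.
- move=> s a f h bf bh.
  have bl : bfun (fun p => a * f p + h p).
    move: bf bh => [K fK] [K' hK]; exists (`|a| * K + K') => g.
    by rewrite (le_trans (ler_normD _ _))// lerD// normrM ler_wpM2l.
  rewrite /m (_ : phi _ _ = a%:C *: phi _ f + phi _ h).
    rewrite blinD blinZ; set x := sigma _ _; set y := sigma _ _.
    case: x => x1 x2; case: y => y1 y2.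
    by rewrite [LHS](_ : _ = a * x1 - 0 * x2 + y1)// mul0r subr0.
  apply: blin_dense => p.
  rewrite [RHS](_ : _ = a%:C * phi _ f (delta p) + phi _ h (delta p))//.
  by rewrite !phid// rmorphD rmorphM.
- move=> s f K fK; rewrite /m (le_trans (Re_le_rnorm _))//.
  rewrite (le_trans (opnormP _ _))//.
  have := opnormP sigma (delta s); rewrite delta_norm mulr1 => sn.
  have K0 : 0 <= K by exact: le_trans (normr_ge0 _) (fK (s, s)).
  have pK : rnorm (phi (S * S)%type f) <= K.
    apply: opnorm_le => // g; rewrite phiE; last by exists K.
    exact/pair_sum_bound/cplx_le.
  by rewrite ler_pM ?opnorm_ge0 ?rnorm_ge0.
- move=> s t f bf; rewrite /m -sd sl.
  rewrite [X in complex.Re X](_ : _ =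
    sigma (delta t) (adjoint (lact Q (delta s)) (phi _ f)))//.
  congr (complex.Re (sigma _ _)).
  have bf' : bfun (fun p => f (s * p.1, p.2)%g).
    by move: bf => [K fK]; exists K.
  apply: blin_dense => -[x w]; rewrite phid// adjointE -ell1_tens_delta.
  rewrite -/(tens Q _ _) lactE sd.
  by rewrite [tens _ _ _]ell1_tens_delta phid.
- move=> s t f bf; rewrite /m -sd sr.
  rewrite [X in complex.Re X](_ : _ =
    sigma (delta s) (adjoint (ract Q (delta t)) (phi _ f)))//.
  congr (complex.Re (sigma _ _)).
  have bf' : bfun (fun p => f (p.1, p.2 * t)%g).
    by move: bf => [K fK]; exists K.
  apply: blin_dense => -[x w]; rewrite phid// adjointE -ell1_tens_delta.
  rewrite -/(tens Q _ _) ractE sd.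
  by rewrite [tens _ _ _]ell1_tens_delta phid.
- move=> s f bf; rewrite /m.
  have bf' : bfun (fun p => f (p.1 * p.2)%g).
    by move: bf => [K fK]; exists K.
  have -> : phi _ (fun p => f (p.1 * p.2)%g) = adjoint (prod_map Q) (phi _ f).
    apply: blin_dense => -[x w]; rewrite phid// adjointE -ell1_tens_delta.
    by rewrite -/(tens Q _ _) prod_mapE sd phid.
  have := congr1 (fun z : dual (dual A) => z (phi _ f)) (sp (delta s)).
  by rewrite kappaE phid// => /(congr1 (@complex.Re R)).
Qed.

End VirtualDiagonal.

(** An infinite set would contain a finite subset with [N.+1] elements, so [A] is finite and may
    itself be taken as [X]. *)
Lemma card_le_fset (T : choiceType) (A : set T) (N : nat) :
  (forall X : {fset T}, [set` X] `<=` A -> (#|` X| <= N)%N) -> (A #<= `I_N)%card.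
Proof.
move=> AN; have [finA|infA] := pselect (finite_set A).
  have AI : (A #= `I_(#|` fset_set A|))%card.
    by rewrite -[in X in (X #= _)%card](fset_setK finA); apply/card_eq_fsetP.
  rewrite (card_le_eql AI) card_le_II; apply: AN.
  by rewrite fset_setK.
have [B BA /leq_trans/(_ (AN _ BA))] := infinite_set_fset N.+1 infA.
by rewrite ltnn.
Qed.

Section BiflatOnlyIf.
Context {R : realType} {S : semigroupType} (HS : clifford_semigroup S).
Local Notation A := (conv_alg R S).
Local Notation supp := (supp HS).
Implicit Types e : idem S.

Lemma boolr_le1 (b : bool) : `|(b%:R : R)| <= 1.
Proof. by case: b; rewrite ?normr1// normr0 ler01. Qed.

Lemma bounded_bool (X : Type) (b : X -> bool) :
  bounded_function (fun p => (b p)%:R : R).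
Proof. by exists 1 => p; exact: boolr_le1. Qed.

(** The support of a product is the meet of the supports, and lying below a meet means lying below
    both terms. *)
Lemma le_suppM (f : idem S) (x w : S) :
  (val f * val (supp (x * w)) == val f)%g =
  (val f * val (supp x) == val f)%g && (val f * val (supp w) == val f)%g.
Proof.
rewrite suppM; apply/eqP/andP => [fxw|[/eqP fx /eqP fw]].
  split; apply/eqP; rewrite -[in LHS]fxw.
    rewrite -!mulgA [(val (supp w) * _)%g](idem_central HS) (mulgA (val (supp x))).
    by rewrite idem_mulgg.
  by rewrite -!mulgA idem_mulgg.
by rewrite mulgA fx fw.
Qed.

Lemma biflat_ulf : biflat A -> uniformly_locally_finite S.
Proof.
move=> /biflat_virtual_diagonal[m [C [ml mb mL mR mP]]].
exists (Num.bound C) => e; apply: card_le_fset => X Xe.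
pose F (f : idem S) (p : S * S) : R :=
  ((supp p.1 == f) && (val f * val (supp p.2) == val f)%g)%:R.
pose g (f : idem S) (u : S) : R := (val f * val (supp u) == val f)%g%:R.
have bF f : bounded_function (F f) by exact: bounded_bool.
have mF f : idem_le f e -> m (val e) (F f) = 1.
  (* Both [f e] and [e f] equal [f], so [m f (F f)] is computed in two ways from [m e]. Right
     translation by [f] fixes [F f]; left translation turns the condition |x| = f into |x| >= f,
     which leaves a function of the product [x w]. *)
  move=> fe; have ef : (val f * val e)%g = val f by [].
  have fe' : (val e * val f)%g = val f by rewrite (idem_central HS).
  have := mL (val f) (val e) _ (bF f); rewrite ef.
  have := mR (val e) (val f) _ (bF f); rewrite fe' => ->.
  rewrite (_ : (fun p => F f (p.1, (p.2 * val f)%g)) = F f); last first.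
    apply/funext => -[x w]; rewrite /F/=; congr ((_ && _)%:R).
    by rewrite le_suppM supp_idem idem_mulgg eqxx andbT.
  move=> ->; rewrite (_ : (fun _ => _) = (fun p => g f (p.1 * p.2)%g)).
    rewrite mP; last exact: bounded_bool.
    by rewrite /g supp_idem ef eqxx.
  apply/funext => -[x w]; rewrite /F /g/= le_suppM; congr ((_ && _)%:R).
  rewrite -(inj_eq val_inj) suppM supp_idem.
  by [].
have m0 s : m s (fun=> 0) = 0.
  have := ml s (-1) (fun=> 0) (fun=> 0).
  rewrite (_ : (fun=> -1 * 0 + 0) = (fun=> 0)); last first.
    by apply/funext => p; rewrite mulr0 addr0.
  have b0 : bounded_function (fun _ : S * S => 0 : R) by exists 0 => p; rewrite normr0.
  by move=> /(_ b0 b0); lra.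
have mS (r : seq (idem S)) : (forall f, f \in r -> idem_le f e) ->
    bounded_function (fun p => \sum_(f <- r) F f p) /\
    m (val e) (fun p => \sum_(f <- r) F f p) = (size r)%:R.
  elim: r => [_|f r IH re].
    rewrite (_ : (fun _ => _) = (fun=> 0)); last first.
      by apply/funext => p; rewrite big_nil.
    by split; [exists 0 => p; rewrite normr0|rewrite m0].
  have [|[K rK] mr] := IH; first by move=> h hr; apply: re; rewrite inE hr orbT.
  rewrite (_ : (fun _ => _) = (fun p => 1 * F f p + \sum_(f <- r) F f p)); last first.
    by apply/funext => p; rewrite big_cons mul1r.
  split.
    exists (1 + K) => p; rewrite mul1r (le_trans (ler_normD _ _))// lerD//.
    exact: boolr_le1.
  rewrite ml//; last by exists K.
  by rewrite mr mF ?mulr1 ?natr1 1?addrC ?natr1//; apply: re; rewrite inE eqxx.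
have [_ mX] := mS X (fun f fX => Xe f fX).
(* At most one term is nonzero, the one with [f = supp p.1]. Hence the bound stays 1 while the
   integral is the number of elements of [X]. *)
have FX (p : S * S) : `|\sum_(f <- X) F f p| <= 1.
  have [pX|pX] := boolP (supp p.1 \in X).
    rewrite (big_fsetD1 _ pX)/= big_seq big1 ?addr0; first exact: boolr_le1.
    by move=> f; rewrite !inE /F eq_sym => /andP[/negPf -> _].
  rewrite big_seq big1 ?normr0 ?ler01// => f fX.
  by rewrite /F; case: eqP => // pf; move: pX; rewrite pf fX.
have XC : (#|` X|)%:R <= C.
  have := mb (val e) _ _ FX; rewrite mX mulr1; apply: le_trans.
  by rewrite ler_norm.
have C0 : 0 <= C by rewrite (le_trans _ XC).
by have := le_lt_trans XC (archi_boundP C0); rewrite ltr_nat => /ltnW.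
Qed.

Lemma biflat_amenable e : biflat A -> amenable R (maxgroup e).
Proof.
move=> /biflat_virtual_diagonal[m [C [ml mb mL mR mP]]].
pose ge (x : S) := (val e * val (supp x) == val e)%g.
(* Extension of [f] to [S] along x |-> e x. The default 0 is harmless: where [ge x] holds, [e x]
   lies in the group by [maxgroup_restrict]. *)
pose ext (f : maxgroup e -> R) (x : S) : R :=
  if insub (val e * x)%g is Some y then f y else 0.
pose F f (p : S * S) : R := (ge p.1 && ge p.2)%:R * ext f p.1.
have extK f (K : R) : 0 <= K -> (forall y, `|f y| <= K) -> forall x, `|ext f x| <= K.
  by move=> K0 fK x; rewrite /ext; case: insub => [y|]; rewrite ?normr0.
have FK f (K : R) : (forall y, `|f y| <= K) -> forall p, `|F f p| <= K.
  move=> fK p; have K0 : 0 <= K := le_trans (normr_ge0 _) (fK 1%g).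
  by rewrite normrM -[K]mul1r ler_pM ?boolr_le1// (extK f).
have bF f : bounded_function f -> bounded_function (F f).
  by move=> [K fK]; exists K; exact: FK.
apply: (@amenable_of_bounded_invariant _ _ (fun f => m (val e) (F f)) C).
- move=> a f h bf bh; rewrite -ml; do ?exact: bF.
  congr m; apply/funext => p; rewrite /F mulrCA -mulrDr; congr (_ * _).
  by rewrite /ext; case: insub => //; rewrite mulr0 addr0.
- by move=> f K fK; apply: mb; exact: FK.
(* For the constant 1, [F] is the indicator of |xw| >= e, a function of the product, so its integral
   is the value at [e]. *)
- rewrite (_ : F _ = (fun p => (ge (p.1 * p.2)%g)%:R)).
    rewrite (mP _ (fun x => (ge x)%:R)); last exact: bounded_bool.
    by rewrite /ge supp_idem idem_mulgg eqxx.
  apply/funext => p; rewrite /F /ge le_suppM; case: eqP => //= p1;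
    last by rewrite mul0r.
  case: eqP => // p2; rewrite ?mul0r// mul1r /ext.
  by rewrite insubT ?maxgroup_restrict.
move=> f x bf.
have xe : (val x * val e)%g = val x.
  by have /asboolP[] := valP x.
have ex : (val e * val x)%g = val x.
  by have /asboolP[] := valP x.
have bf' : bounded_function (fun g => f (x * g)%g).
  by move: bf => [K fK]; exists K.
(* Since [x e = e x = x], both invariances evaluate [m x (F f)]. Right translation by [x] preserves
   the condition |w| >= e, while left translation acts on [f] itself. *)
have := mL (val x) (val e) _ (bF f bf); rewrite xe.
have := mR (val e) (val x) _ (bF f bf); rewrite ex => ->.
have gex : ge (val x) by rewrite /ge supp_maxgroup idem_mulgg.
rewrite (_ : (fun p => F f (p.1, (p.2 * val x)%g)) = F f); last first.
  by apply/funext => p; rewrite /F/= /ge le_suppM -/(ge (val x)) gex andbT.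
move=> ->; congr m; apply/funext => -[u w]; rewrite /F/= [ge (val x * u)%g]le_suppM.
rewrite -/(ge (val x)) -/(ge u) gex andTb.
have [gu|] := boolP (ge u); last by rewrite !mul0r.
congr (_ * _); rewrite /ext.
have eu : maxgroup_pred e (val e * u)%g by apply: maxgroup_restrict; exact/eqP.
have exu : maxgroup_pred e (val e * (val x * u))%g.
  apply: maxgroup_restrict; apply/eqP.
  by rewrite le_suppM; apply/andP.
rewrite !insubT/=; congr f; apply: val_inj.
have : (val e * (val x * u))%g = (val x * (val e * u))%g.
  by rewrite mulgA ex -[in LHS]xe -mulgA.
by [].
Qed.

End BiflatOnlyIf.

(** * Minimal idempotents of l^1(S) *)

Section BanachAlgebraSums.
Context {R : realType} {A : banachAlgType R}.
Implicit Types a b : A.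

Fact bamul_rnormC b a : rnorm (bamul a b) <= rnorm b * rnorm a.
Proof. by rewrite mulrC bamul_rnorm. Qed.

Definition lmul a : blin A A := mk_blin (bamul_linearr a) (bamul_rnorm a).
Definition rmul b : blin A A := mk_blin (bamul_linearl b) (bamul_rnormC b).

Lemma bamul_sumr a (I : Type) (r : seq I) (P : pred I) (E : I -> A) :
  bamul a (\sum_(i <- r | P i) E i) = \sum_(i <- r | P i) bamul a (E i).
Proof. exact: (blin_sum (lmul a)). Qed.

Lemma bamul_suml b (I : Type) (r : seq I) (P : pred I) (E : I -> A) :
  bamul (\sum_(i <- r | P i) E i) b = \sum_(i <- r | P i) bamul (E i) b.
Proof. exact: (blin_sum (rmul b)). Qed.

Lemma bamulBr a b c : bamul a (b - c) = bamul a b - bamul a c.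
Proof. exact: (linearB (lmul a)). Qed.

Lemma bamulBl a b c : bamul (a - b) c = bamul a c - bamul b c.
Proof. exact: (linearB (rmul c)). Qed.

Lemma bamulr0 a : bamul a 0 = 0.
Proof. exact: (blin0 (lmul a)). Qed.

End BanachAlgebraSums.

(** * Finite down-sets of idempotents *)

Section LocallyFinite.
Context {S : semigroupType} (HS : clifford_semigroup S).
Hypothesis ulf : uniformly_locally_finite S.
Implicit Types e f y z : idem S.

Definition ulf_bound : nat := sval (cid ulf).

Definition below e : {fset idem S} := fset_set [set y : idem S | idem_le y e].

Let below_card e : ([set y : idem S | idem_le y e] #<= `I_ulf_bound)%card.
Proof. by rewrite /ulf_bound; case: cid. Qed.

Let below_finite e : finite_set [set y : idem S | idem_le y e].
Proof. exact: (card_le_finite (below_card e) (finite_II _)). Qed.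

Lemma in_below y e : (y \in below e) = (val y * val e == val y)%g.
Proof.
by rewrite in_fset_set// ; apply/idP/eqP => [/set_mem|h]; [|apply: mem_set].
Qed.

Lemma size_below e : (#|` below e| <= ulf_bound)%N.
Proof. exact/geq_card_fset_set/below_card. Qed.

Lemma below_refl e : e \in below e.
Proof. by rewrite in_below idem_mulgg. Qed.

Lemma below_trans y e z : z \in below y -> y \in below e -> z \in below e.
Proof.
by rewrite !in_below => /eqP zy /eqP ye; rewrite -{1}zy -mulgA ye zy.
Qed.

Lemma size_below_lt y z : z \in (below y `\ y)%fset ->
  (#|` below z| < #|` below y|)%N.
Proof.
rewrite !inE => /andP[zy zby]; apply: fproper_ltn_card.
rewrite fproperE; apply/andP; split.
  by apply/fsubsetP => x xz; exact: below_trans xz zby.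
apply: contra zy => /fsubsetP/(_ _ (below_refl y)) yz; move: zby yz.
rewrite !in_below => /eqP zy /eqP yz.
by rewrite -(inj_eq val_inj) -yz -(idem_central HS) zy.
Qed.

(** Well-founded induction along the order, measured by the cardinality of the down-set, which
    strictly drops below [y]. *)
Lemma idem_ind (P : idem S -> Prop) :
  (forall y, (forall z, z \in (below y `\ y)%fset -> P z) -> P y) ->
  forall y, P y.
Proof.
move=> IH y; have [n] := ubnP #|` below y|; elim: n y => // n IHn y yn.
by apply: IH => z /size_below_lt zy; apply: IHn; exact: leq_trans zy _.
Qed.

(** The meet of [e] and [f]; passing through [supp] packages the product as an element of
    [idem S]. *)
Definition inf_idem e f : idem S := supp HS (val e * val f)%g.

Lemma inf_idemE e f : val (inf_idem e f) = (val e * val f)%g.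
Proof. by rewrite /inf_idem suppM !supp_idem. Qed.

Lemma in_below_inf z y f :
  (z \in below (inf_idem y f)) = (z \in below y) && (z \in below f).
Proof.
rewrite !in_below inf_idemE.
have := le_suppM HS z (val y) (val f).
by rewrite suppM !supp_idem.
Qed.

End LocallyFinite.

(** * Moebius inversion over the idempotents *)

Section SemilatticeIdempotents.
Context (R : realType) {S : semigroupType} (HS : clifford_semigroup S).
Hypothesis ulf : uniformly_locally_finite S.
Local Notation A := (conv_alg R S).
Implicit Types e f y z : idem S.

Let idl e : A := delta (val e).

(* Moebius inversion on the finite sets below y; n is fuel, and the value no
   longer depends on it once n >= #|` below y|. *)
Fixpoint rho_rec n y : A :=
  if n is n'.+1 then idl y - \sum_(z <- (below y `\ y)%fset) rho_rec n' z else 0.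

Let rho_rec_stable n m y : (#|` below y| <= n)%N -> (#|` below y| <= m)%N ->
  rho_rec n y = rho_rec m y.
Proof.
have y0 z : (0 < #|` below z|)%N.
  by rewrite cardfs_gt0; apply/fset0Pn; exists z; exact: (below_refl ulf).
elim: n m y => [|n IH] [|m] y; rewrite ?leqn0.
- by [].
- by rewrite -leqn0 leqNgt y0.
- by move=> _; rewrite -leqn0 leqNgt y0.
move=> yn ym /=; congr (_ - _); rewrite big_seq [RHS]big_seq.
apply: eq_bigr => z /(size_below_lt HS ulf) zy; apply: IH.
  by rewrite -ltnS (leq_trans zy).
by rewrite -ltnS (leq_trans zy).
Qed.

Definition rho y : A := rho_rec #|` below y| y.

Lemma rhoE y : rho y = idl y - \sum_(z <- (below y `\ y)%fset) rho z.
Proof.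
rewrite {1}/rho; have [n yn] : exists n, #|` below y| = n.+1.
  exists #|` below y|.-1; rewrite prednK// cardfs_gt0.
  by apply/fset0Pn; exists y; exact: (below_refl ulf).
rewrite yn /=; congr (_ - _); rewrite big_seq [RHS]big_seq.
apply: eq_bigr => z /(size_below_lt HS ulf); rewrite yn ltnS => zn.
exact: rho_rec_stable.
Qed.

Lemma sum_rho y : \sum_(z <- below y) rho z = idl y.
Proof.
by rewrite (big_fsetD1 y (below_refl ulf y))/= {1}rhoE subrK.
Qed.

(** Each level of the recursion adds one basis element and at most [N] terms of the previous level,
    and the depth is at most [ulf_bound]; hence the majorant with [b (n + 1) = 1 + N * b n]. *)
Lemma rho_bound : exists B : R, forall y, rnorm (rho y) <= B.
Proof.
pose N : R := (ulf_bound ulf)%:R.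
pose b := fix b n : R := if n is n'.+1 then 1 + N * b n' else 0.
have N0 : 0 <= N by rewrite ler0n.
have b0 n : 0 <= b n by elim: n => //= n bn; rewrite addr_ge0// mulr_ge0.
have bS n : b n <= b n.+1.
  by elim: n => [|n IH]; rewrite ?b0//=; rewrite lerD2l ler_wpM2l.
have bn n y : rnorm (rho_rec n y) <= b n.
  elim: n y => [|n IH] y /=; first by rewrite rnorm0.
  rewrite (le_trans (rnormD _ _))// delta_norm lerD2l rnormN.
  apply: (@le_trans _ _ (\sum_(z <- (below y `\ y)%fset) b n)).
    elim/big_ind2 : _ => [|x1 x2 y1 y2 h1 h2|z _]; rewrite ?rnorm0//.
    by rewrite (le_trans (rnormD _ _))// lerD.
  rewrite big_const_seq count_predT iter_addr_0 -mulr_natl ler_wpM2r//.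
  rewrite ler_nat (leq_trans _ (size_below ulf y))//.
  exact/fsubset_leq_card/fsubD1set.
exists (b (ulf_bound ulf)) => y; rewrite (le_trans (bn _ _))//.
have := size_below ulf y; move: #|` _| (ulf_bound _) => n m nm.
rewrite -(subnK nm); elim: (m - n)%N => //= k; rewrite -/(b _).
by move=> /le_trans; apply; exact: bS.
Qed.

Let dd (s t : S) : bamul (delta s : A) (delta t) = delta (s * t)%g.
Proof. exact: conv_delta. Qed.

Lemma rho_central (s : S) y : bamul (delta s) (rho y) = bamul (rho y) (delta s).
Proof.
elim/(idem_ind HS ulf) : y => y IH; rewrite rhoE bamulBr bamulBl.
rewrite bamul_sumr bamul_suml !dd (idem_central HS); congr (_ - _).
by rewrite big_seq [RHS]big_seq; exact: eq_bigr.
Qed.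

Lemma rho_mull f y : y \in below f -> bamul (idl f) (rho y) = rho y.
Proof.
elim/(idem_ind HS ulf) : y => y IH yf; rewrite [in LHS]rhoE bamulBr dd.
have -> : (val f * val y)%g = val y.
  by rewrite (idem_central HS); apply/eqP; rewrite -(in_below ulf).
rewrite [RHS]rhoE; congr (_ - _); rewrite bamul_sumr big_seq [RHS]big_seq.
apply: eq_bigr => z zy; apply: IH => //; apply: (below_trans ulf _ yf).
by move: zy; rewrite !inE => /andP[].
Qed.

(** Expand [rho y]. The product of the idempotents [f] and [y] is their meet, whose basis element is
    the sum of [rho z] over the z below it. In the subtracted sum, induction kills the z not below
    [f] and fixes the others. As [y] is not below [f], the same z remain in both, and they
    cancel. *)
Lemma rho_mull0 f y : y \notin below f -> bamul (idl f) (rho y) = 0.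
Proof.
elim/(idem_ind HS ulf) : y => y IH yf; rewrite rhoE bamulBr dd.
rewrite (idem_central HS) -(inf_idemE HS) -/(idl _) -sum_rho bamul_sumr.
apply/eqP; rewrite subr_eq0; apply/eqP.
rewrite [RHS](big_fsetID _ (fun z => z \in below f))/=.
rewrite [X in _ = _ + X]big1_seq; last first.
  by move=> z /andP[_]; rewrite !inE /= => /andP[zy zf]; apply: IH; rewrite ?inE.
rewrite addr0 big_seq [RHS]big_seq.
rewrite [RHS](eq_bigr rho); last first.
  by move=> z; rewrite !inE/= => /andP[_ zf]; exact: rho_mull.
rewrite -!big_seq; apply: eq_fbigl => z; rewrite !inE/= (in_below_inf HS ulf).
have [zf|] := boolP (z \in below f); rewrite ?andbF// !andbT.
rewrite andb_idl// => _; apply: contraNneq yf => <-.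
by [].
Qed.

(** Expand the left factor: the basis element of [y] fixes [rho y]. For z strictly below [y],
    [rho z] absorbs the basis element of z, which annihilates [rho y]. *)
Lemma rho_idem y : bamul (rho y) (rho y) = rho y.
Proof.
rewrite {1}rhoE bamulBl rho_mull ?(below_refl ulf)// bamul_suml big_seq big1 ?subr0//.
move=> z; rewrite !inE => /andP[zy zby].
rewrite -(rho_mull (below_refl ulf z)) rho_central -bamulA rho_mull0 ?bamulr0//.
apply: contra zy; move: zby; rewrite !(in_below ulf) => /eqP zy /eqP yz.
by rewrite -(inj_eq val_inj) -yz -(idem_central HS) zy.
Qed.

End SemilatticeIdempotents.

(** * Virtual diagonals *)

Section ComplexMean.
Context {R : realType} {G : groupType}.
Implicit Types F H : G -> Cx R.

Definition cbounded F := exists K : R, forall g, rnorm (F g) <= K.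

(** The mean acts separately on real and imaginary parts, each bounded by [K]; this is the origin of
    the constant 2. *)
Lemma amenable_complex_mean : amenable R G ->
  exists c : (G -> Cx R) -> Cx R,
  [/\ forall (k : Cx R) F H, cbounded F -> cbounded H ->
        c (fun g => k * F g + H g) = k * c F + c H,
      forall F (K : R), (forall g, rnorm (F g) <= K) -> rnorm (c F) <= 2 * K,
      forall z : Cx R, c (fun=> z) = z
    & forall F x, cbounded F -> c (fun g => F (x * g)%g) = c F].
Proof.
move=> [m [ml mp m1 mi]].
pose re F g := complex.Re (F g); pose im F g := complex.Im (F g).
have bre F : cbounded F -> bounded_function (re F).
  by move=> [K FK]; exists K => g; exact: le_trans (Re_le_rnorm _) (FK g).
have bim F : cbounded F -> bounded_function (im F).
  by move=> [K FK]; exists K => g; exact: le_trans (Im_le_rnorm _) (FK g).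
have b1 (k : R) : bounded_function (fun _ : G => k) by exists `|k|.
have bZ (k : R) f : bounded_function f -> bounded_function (fun g : G => k * f g).
  by move=> [K fK]; exists (`|k| * K) => g; rewrite normrM ler_wpM2l.
have bD f h : bounded_function f -> bounded_function h ->
    bounded_function (fun g : G => f g + h g).
  move=> [K fK] [K' hK]; exists (K + K') => g.
  by rewrite (le_trans (ler_normD _ _))// lerD.
have m0 : m (fun=> 0) = 0.
  have := ml (-1) _ _ (b1 0) (b1 0).
  rewrite (_ : (fun _ => _) = (fun=> 0)); first by lra.
  by apply/funext => g; rewrite mulr0 addr0.
have mZ k f : bounded_function f -> m (fun g => k * f g) = k * m f.
  move=> bf; have := ml k _ _ bf (b1 0); rewrite m0 addr0 => <-.
  by congr m; apply/funext => g; rewrite addr0.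
have mD f h : bounded_function f -> bounded_function h ->
    m (fun g => f g + h g) = m f + m h.
  move=> bf bh; have := ml 1 _ _ bf bh; rewrite mul1r => <-.
  by congr m; apply/funext => g; rewrite mul1r.
have mc k : m (fun=> k) = k.
  have := mZ k _ (b1 1); rewrite m1 mulr1 => {2}<-.
  by congr m; apply/funext => g; rewrite mulr1.
have mb f (K : R) : (forall g, `|f g| <= K) -> `|m f| <= K.
  move=> fK; have bf : bounded_function f by exists K.
  (* Positivity of the mean on [K - s * f]; the signs [s = 1] and [s = -1] together bound the
     absolute value. *)
  have h (s : R) : `|s| = 1 -> s * m f <= K.
    move=> s1; rewrite -subr_ge0.
    have -> : K - s * m f = m (fun g => (- s) * f g + K).
      by rewrite ml// mc; lra.
    apply: mp => [|g]; first exact/bD/b1/bZ.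
    rewrite mulNr addrC subr_ge0 (le_trans _ (fK g))//.
    by rewrite (le_trans (ler_norm _))// normrM s1 mul1r.
  by rewrite ler_norml -{2}[m f]mul1r h ?normr1// andbT lerNl -mulN1r h// normrN1.
exists (fun F => m (re F) +i* m (im F)); split.
- move=> k F H bF bH; case: k => a b.
  rewrite (_ : re (fun g => (a +i* b) * F g + H g) = 
    fun g => (a * re F g + (- b) * im F g) + re H g); last first.
    apply/funext => g; rewrite /re /im; case: (F g) => ? ?; case: (H g) => ? ? /=.
    by rewrite mulNr.
  rewrite (_ : im (fun g => (a +i* b) * F g + H g) = 
    fun g => (a * im F g + b * re F g) + im H g); last first.
    by apply/funext => g; rewrite /re /im; case: (F g) => ? ?; case: (H g).
  have [[rF iF] [rH iH]] := ((bre _ bF, bim _ bF), (bre _ bH, bim _ bH)).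
  rewrite !mD//; do ?[exact: bZ|exact/bD/bZ].
  + by rewrite !mZ// mulNr.
  + by apply: bD; exact: bZ.
  + by apply: bD; exact: bZ.
- move=> F K FK; rewrite (le_trans (rnorm_le_ReIm _))//= mulr_natl mulr2n lerD//.
    by apply: mb => g; exact: le_trans (Re_le_rnorm _) (FK g).
  by apply: mb => g; exact: le_trans (Im_le_rnorm _) (FK g).
- by move=> [a b]; rewrite (mc a) (mc b).
- move=> F x bF; rewrite -[in RHS](mi (re F) x)//; last exact: bre.
  by rewrite -[in RHS](mi (im F) x)//; exact: bim.
Qed.

End ComplexMean.

(** * Module actions and second adjoints *)

Section TensorMaps.
Context {R : realType} {A : banachAlgType R} (P : proj_tensor A A).
Implicit Types a b : A.

(** Both maps are the lift of the bilinear map induced by [G]. *)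
Lemma tens_ext (Y : completeNormedModType (Cx R)) (F G : blin P Y) :
  (forall a b, F (tens P a b) = G (tens P a b)) -> F = G.
Proof.
move=> FG; have [tl tr tn] := tens_bilinear P.
have bb : bounded_bilinear (fun a b => G (tens P a b)) (opnorm G).
  split=> [b k x y|a k x y|a b].
  - by rewrite tl (blin_linear G).
  - by rewrite tr (blin_linear G).
  rewrite (le_trans (opnormP G _))// ler_wpM2l ?opnorm_ge0//.
  by rewrite (le_trans (tn _ _))// mul1r.
rewrite (tens_lift_uniq (opnorm_ge0 G) bb FG).
by rewrite -(tens_lift_uniq (opnorm_ge0 G) bb (fun _ _ => erefl)).
Qed.

Lemma lact_comp a b : blin_comp (lact P a) (lact P b) = lact P (bamul a b).
Proof. by apply: tens_ext => x y /=; rewrite !lactE bamulA. Qed.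

Lemma ract_comp a b : blin_comp (ract P a) (ract P b) = ract P (bamul b a).
Proof. by apply: tens_ext => x y /=; rewrite !ractE bamulA. Qed.

Lemma lact_ract a b : blin_comp (lact P a) (ract P b) = blin_comp (ract P b) (lact P a).
Proof. by apply: tens_ext => x y /=; rewrite !(ractE, lactE). Qed.

Lemma lact_linear : linear (lact P).
Proof.
move=> k a b; apply: tens_ext => x y; have [tl tr _] := tens_bilinear P.
by rewrite [RHS]blinDZE !lactE -tl bamul_linearl.
Qed.

Lemma ract_linear : linear (ract P).
Proof.
move=> k a b; apply: tens_ext => x y; have [tl tr _] := tens_bilinear P.
by rewrite [RHS]blinDZE !ractE -tr bamul_linearr.
Qed.

Lemma biadjoint_comp (V1 V2 V3 : normedModType (Cx R)) (g : blin V2 V3)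
    (f : blin V1 V2) x :
  biadjoint g (biadjoint f x) = biadjoint (blin_comp g f) x.
Proof. by apply: blinP => phi /=; congr (x _); apply: blinP. Qed.

Lemma biadjoint_linear (V W : normedModType (Cx R)) (x : dual (dual V)) :
  linear (fun T : blin V W => biadjoint T x).
Proof.
move=> k S T; apply: blinP => phi.
rewrite [RHS]blinDZE [LHS](_ : _ = x (adjoint (k *: S + T) phi))//.
rewrite (_ : adjoint _ _ = k *: adjoint S phi + adjoint T phi).
  exact: (blin_linear x).
by apply: blinP => v; rewrite [RHS]blinDZE !adjointE blinDZE (blin_linear phi).
Qed.

Lemma opnorm_biadjoint (V W : normedModType (Cx R)) (T : blin V W) :
  opnorm (biadjoint T) <= opnorm T.
Proof.
rewrite (le_trans (opnorm_mk_blin _ _ _)) ?opnorm_ge0//.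
by apply: opnorm_mk_blin; exact: opnorm_ge0.
Qed.

Lemma biadjoint_bound (V W : normedModType (Cx R)) (T : blin V W) x (M : R) :
  opnorm T <= M -> rnorm (biadjoint T x) <= M * rnorm x.
Proof.
move=> TM; rewrite (le_trans (opnormP _ _))// ler_wpM2r ?rnorm_ge0//.
exact: le_trans (opnorm_biadjoint T) TM.
Qed.

Lemma opnorm_lact a : opnorm (lact P a) <= rnorm a.
Proof. exact: tens_lift_norm. Qed.

Lemma opnorm_ract a : opnorm (ract P a) <= rnorm a.
Proof. exact: tens_lift_norm. Qed.

End TensorMaps.

(** * Construction of the splitting map *)

Section BiflatIf.
Context {R : realType} {S : semigroupType} (HS : clifford_semigroup S).
Hypothesis ulf : uniformly_locally_finite S.
Hypothesis am : forall e : idem S, amenable R (maxgroup e).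
Local Notation A := (conv_alg R S).
Variable P : proj_tensor A A.
Local Notation supp := (supp HS).
Local Notation rho := (rho R).
Implicit Types (e y z : idem S) (s t a : S).

Let d s : A := delta s.

Let dd s t : bamul (d s) (d t) = d (s * t)%g.
Proof. exact: conv_delta. Qed.

Let cmean y : (maxgroup y -> Cx R) -> Cx R :=
  sval (cid (amenable_complex_mean (am y))).

Let cmeanP y : [/\ forall (k : Cx R) F H, cbounded F -> cbounded H ->
        @cmean y (fun g => k * F g + H g) = k * @cmean y F + @cmean y H,
      forall F (K : R), (forall g, rnorm (F g) <= K) -> rnorm (@cmean y F) <= 2 * K,
      forall z : Cx R, @cmean y (fun=> z) = z
    & forall F x, cbounded F -> @cmean y (fun g => F (x * g)%g) = @cmean y F].
Proof. by rewrite /cmean; case: cid. Qed.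

Let ten s t : P := tens P (d s) (d t).

Let ten_bound (phi : dual P) s t : rnorm (phi (ten s t)) <= rnorm phi.
Proof.
rewrite (le_trans (opnormP _ _))// ler_piMr ?opnorm_ge0//.
by have [_ _ /(_ _ _)/le_trans] := tens_bilinear P; apply; rewrite !delta_norm !mulr1.
Qed.

Let diag_fun y a (phi : dual P) : Cx R :=
  @cmean y (fun x => phi (ten (val x) (val x^-1%g * a)%g)).

Let diag_cbounded y a (phi : dual P) :
  cbounded (fun x : maxgroup y => phi (ten (val x) (val x^-1%g * a)%g)).
Proof. by exists (rnorm phi) => x; exact: ten_bound. Qed.

Let diag_linear y a : linear (diag_fun y a).
Proof.
move=> k phi psi; have [cl _ _ _] := cmeanP y.
by rewrite /diag_fun -[RHS]cl.
Qed.

Let diag_bound y a phi : rnorm (diag_fun y a phi) <= 2 * rnorm phi.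
Proof.
have [_ cb _ _] := cmeanP y.
by apply: cb => x; exact: ten_bound.
Qed.

(* The virtual diagonal of the group algebra of maxgroup y, translated by a. *)
Definition diag y a : dual (dual P) := mk_blin (@diag_linear y a) (@diag_bound y a).

(** Invariance of the mean allows replacing x by kx, and the second leg [(kx)^-1 k a] is
    [x^-1 a]. *)
Lemma diag_lact y (k : maxgroup y) a :
  biadjoint (lact P (d (val k))) (diag y a) = diag y (val k * a)%g.
Proof.
apply: blinP => phi.
rewrite [LHS](_ : _ = diag_fun y a (adjoint (lact P (d (val k))) phi))//.
rewrite [RHS](_ : _ = diag_fun y (val k * a)%g phi)// /diag_fun.
have [_ _ _ ci] := cmeanP y.
rewrite -[RHS](ci _ k); last exact: diag_cbounded.
congr (@cmean _ _); apply/funext => x; rewrite adjointE /ten lactE dd.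
congr (phi (tens _ _ (d _))); rewrite mulgA; congr (_ * _)%g.
rewrite [RHS](_ : _ = val ((k * x)^-1 * k)%g)//.
by rewrite invgM mulgVK.
Qed.

Lemma diag_ract y s a : biadjoint (ract P (d s)) (diag y a) = diag y (a * s)%g.
Proof.
apply: blinP => phi.
rewrite [LHS](_ : _ = diag_fun y a (adjoint (ract P (d s)) phi))//.
rewrite [RHS](_ : _ = diag_fun y (a * s)%g phi)// /diag_fun.
by congr (@cmean _ _); apply/funext => x; rewrite adjointE /ten ractE dd mulgA.
Qed.

(** The second leg starts with [x^-1] from the group at [y], which absorbs the identity [val y]. *)
Lemma diag_restrict y s a : diag y (val y * s * a)%g = diag y (s * a)%g.
Proof.
apply: blinP => phi.
rewrite [LHS](_ : _ = diag_fun y (val y * s * a)%g phi)//.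
rewrite [RHS](_ : _ = diag_fun y (s * a)%g phi)// /diag_fun.
congr (@cmean _ _); apply/funext => x; congr (phi (ten _ _)).
rewrite !mulgA; congr (_ * _ * _)%g.
by rewrite [LHS](_ : _ = val (x^-1 * 1)%g)// mulg1.
Qed.

(** Compression by [rho y] on both sides: the basis element of [s] then acts through its restriction
    [y s] to the group at [y], or as 0 if [y] is not below [supp s]. *)
Definition part y a : dual (dual P) :=
  biadjoint (lact P (rho y)) (biadjoint (ract P (rho y)) (diag y a)).

(** If [y] is below [supp s], [rho y] absorbs the basis element of [y], which restricts [s].
    Otherwise [s] absorbs its support, whose basis element annihilates [rho y]. *)
Let rhod s y : bamul (d s) (rho y) =
  if y \in below (supp s) then bamul (rho y) (d (val y * s)%g) else 0.
Proof.
case: ifPn => ys.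
  rewrite (rho_central R HS ulf) -{1}(rho_mull R HS ulf (below_refl ulf y)).
  by rewrite (rho_central R HS ulf) -bamulA dd.
have -> : d s = bamul (d s) (d (val (supp s))).
  by rewrite dd -(idem_central HS) mul_supp.
by rewrite -bamulA (rho_mull0 R HS ulf ys) bamulr0.
Qed.

Let biadjoint0 (V W : normedModType (Cx R)) (x : dual (dual V)) :
  biadjoint (0 : blin V W) x = 0.
Proof.
have := biadjoint_linear x (-1) (0 : blin V W) 0.
by rewrite scaler0 addr0 scaleN1r addNr.
Qed.

Let lact0 : lact P 0 = 0.
Proof.
by have := lact_linear P (-1) 0 0; rewrite scaler0 addr0 scaleN1r addNr.
Qed.

Let ract0 : ract P 0 = 0.
Proof.
by have := ract_linear P (-1) 0 0; rewrite scaler0 addr0 scaleN1r addNr.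
Qed.

(** By [rhod] the action passes through [rho y] as that of [y s], an element of the group at [y];
    there [diag_lact] applies, and [diag_restrict] removes the extra [y]. *)
Lemma part_lact y s a : biadjoint (lact P (d s)) (part y a) =
  if y \in below (supp s) then part y (s * a)%g else 0.
Proof.
rewrite /part biadjoint_comp lact_comp rhod; case: ifPn => ys; last first.
  by rewrite lact0 biadjoint0.
rewrite -lact_comp -biadjoint_comp; congr (biadjoint _ _).
rewrite biadjoint_comp lact_ract -biadjoint_comp; congr (biadjoint _ _).
have ysP : maxgroup_pred y (val y * s)%g.
  by apply: maxgroup_restrict; apply/eqP; rewrite -(in_below ulf); exact: ys.
by rewrite (diag_lact (MaxGroup ysP)) diag_restrict.
Qed.

Lemma part_ract y s a : biadjoint (ract P (d s)) (part y a) =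
  if y \in below (supp s) then part y (a * s)%g else 0.
Proof.
rewrite /part biadjoint_comp -lact_ract -biadjoint_comp.
rewrite [X in biadjoint _ X]biadjoint_comp ract_comp -(rho_central R HS ulf).
case: ifPn => ys; last first.
  by rewrite rhod (negPf ys) ract0 biadjoint0 (blin0 (biadjoint _)).
congr (biadjoint _ _).
rewrite -(ract_comp P (rho y)) -(biadjoint_comp (ract P (rho y))).
by congr (biadjoint _ _); exact: diag_ract.
Qed.

(** As [rho y] is a central idempotent absorbing [x x^-1 = y], the averaged function is constant in
    x. *)
Lemma part_prod y a :
  biadjoint (prod_map P) (part y a) = kappa A (bamul (rho y) (d a)).
Proof.
apply: blinP => phi; rewrite kappaE.
rewrite [LHS](_ : _ = diag_fun y a (adjoint (ract P (rho y))
  (adjoint (lact P (rho y)) (adjoint (prod_map P) phi))))//.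
rewrite /diag_fun (_ : (fun _ => _) = (fun=> phi (bamul (rho y) (d a)))).
  by have [_ _ cc _] := cmeanP y; rewrite cc.
apply/funext => x; rewrite !adjointE /ten ractE lactE prod_mapE; congr (phi _).
rewrite (rho_central R HS ulf) -bamulA (bamulA (d (val x))) (rho_central R HS ulf).
rewrite -bamulA (bamulA (rho y)) (rho_idem R HS ulf) dd mulgA.
have -> : (val x * val x^-1)%g = val y.
  by rewrite [LHS](_ : _ = val (x * x^-1)%g)// mulgV.
rewrite -dd bamulA -(rho_central R HS ulf).
by rewrite [bamul (d (val y)) _](rho_mull R HS ulf (below_refl ulf y)).
Qed.

Lemma part_bound : exists B : R, forall y a, rnorm (part y a) <= B.
Proof.
have [B rB] := rho_bound R ulf.
(* One factor [B] for each compression by [rho y], and 2 from the complex mean. *)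
exists (B * (B * 2)) => y a.
have B0 : 0 <= B by exact: le_trans (rnorm_ge0 _) (rB y).
rewrite (le_trans (biadjoint_bound _ (opnorm_lact P _)))//.
rewrite ler_pM ?rnorm_ge0// (le_trans (biadjoint_bound _ (opnorm_ract P _)))//.
by rewrite ler_pM ?rnorm_ge0//; apply: opnorm_mk_blin.
Qed.

Definition virtual_diag a : dual (dual P) := \sum_(y <- below (supp a)) part y a.

Lemma virtual_diag_bound :
  exists2 B : R, 0 <= B & forall a, rnorm (virtual_diag a) <= B.
Proof.
have [B pB] := part_bound; exists ((ulf_bound ulf)%:R * `|B|).
  by rewrite mulr_ge0 ?ler0n.
move=> a; apply: (@le_trans _ _ (\sum_(y <- below (supp a)) `|B|)).
  rewrite /virtual_diag.
  elim/big_ind2 : _ => [|x1 x2 y1 y2 h1 h2|y _]; rewrite ?rnorm0//.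
    by rewrite (le_trans (rnormD _ _))// lerD.
  exact: le_trans (pB _ _) (ler_norm _).
rewrite big_const_seq count_predT iter_addr_0 -(mulr_natl `|B|) ler_wpM2r//.
by rewrite ler_nat size_below.
Qed.

Let below_suppM s t y :
  (y \in below (supp (s * t)%g)) = (y \in below (supp s)) && (y \in below (supp t)).
Proof. by rewrite !(in_below ulf) le_suppM. Qed.

Let sum_below e f (F : idem S -> dual (dual P)) :
  \sum_(y <- below e) (if y \in below f then F y else 0) =
  \sum_(y <- below e | y \in below f) F y.
Proof. by rewrite [RHS]big_mkcond. Qed.

(** The summands that survive are those with [y] below both supports, that is, below the support of
    [s * t]. *)
Lemma virtual_diag_lact s t :
  virtual_diag (s * t)%g = biadjoint (lact P (d s)) (virtual_diag t).
Proof.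
rewrite [RHS]blin_sum; under [RHS]eq_bigr do rewrite part_lact.
rewrite sum_below -big_filter /virtual_diag; apply: perm_big.
apply: uniq_perm; rewrite ?filter_uniq ?fset_uniq// => y.
by rewrite mem_filter; exact: below_suppM.
Qed.

Lemma virtual_diag_ract s t :
  virtual_diag (s * t)%g = biadjoint (ract P (d t)) (virtual_diag s).
Proof.
rewrite [RHS]blin_sum; under [RHS]eq_bigr do rewrite part_ract.
rewrite sum_below -big_filter /virtual_diag; apply: perm_big.
apply: uniq_perm; rewrite ?filter_uniq ?fset_uniq// => y.
by rewrite mem_filter andbC; exact: below_suppM.
Qed.

(** The [rho y] with [y] below [supp a] add up to the basis element of [supp a], which fixes that of
    [a]. *)
Lemma virtual_diag_prod a :
  biadjoint (prod_map P) (virtual_diag a) = kappa A (d a).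
Proof.
rewrite blin_sum; under eq_bigr do rewrite part_prod.
by rewrite -blin_sum -bamul_suml (sum_rho R HS ulf) dd mul_supp.
Qed.

Let B := s2val (cid2 virtual_diag_bound).
Let B0 : 0 <= B. Proof. by rewrite /B; case: cid2. Qed.
Let vB a : rnorm (virtual_diag a) <= B.
Proof. by rewrite /B; case: cid2. Qed.

Let coeff_bound (phi : dual P) a : rnorm (virtual_diag a phi) <= B * rnorm phi.
Proof.
by rewrite (le_trans (opnormP _ _))// ler_wpM2r ?rnorm_ge0//; exact: vB.
Qed.

Section Sigma.
Variable f : A.
(** Extension from the basis in the weak sense: for fixed [phi] the coefficients form a bounded
    family, which is paired with [f]. *)
Let sigma_at (phi : dual P) : Cx R := pair_sum (fun a => virtual_diag a phi) f.

Let sigma_at_linear : linear sigma_at.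
Proof.
move=> k phi psi; rewrite /sigma_at.
(* [pair_sumDr] takes one bound for both families; the sum of the two bounds serves. *)
have h1 a : rnorm (virtual_diag a phi) <= B * rnorm phi + B * rnorm psi.
  by rewrite (le_trans (coeff_bound _ _))// lerDl mulr_ge0 ?rnorm_ge0.
have h2 a : rnorm (virtual_diag a psi) <= B * rnorm phi + B * rnorm psi.
  by rewrite (le_trans (coeff_bound _ _))// lerDr mulr_ge0 ?rnorm_ge0.
apply: etrans (pair_sumDr k f h1 h2); apply: (congr1 (pair_sum ^~ f)).
by apply/funext => a; exact: (blin_linear (virtual_diag a)).
Qed.

Let sigma_at_bound phi : rnorm (sigma_at phi) <= B * rnorm f * rnorm phi.
Proof.
by rewrite mulrAC; apply: pair_sum_bound => a; exact: coeff_bound.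
Qed.

Definition sigma_elt : dual (dual P) := mk_blin sigma_at_linear sigma_at_bound.

Lemma sigma_elt_bound : rnorm sigma_elt <= B * rnorm f.
Proof. by apply: opnorm_mk_blin; rewrite mulr_ge0 ?rnorm_ge0. Qed.
End Sigma.

Lemma sigma_linear : linear sigma_elt.
Proof.
move=> k f g; apply: blinP => phi.
exact: (pair_sum_linear (coeff_bound phi)).
Qed.

Definition sigma : blin A (dual (dual P)) := mk_blin sigma_linear sigma_elt_bound.

Lemma sigma_delta a : sigma (d a) = virtual_diag a.
Proof. by apply: blinP => phi; exact: pair_sum_delta. Qed.

Let biadj_lact_linear (x : dual (dual P)) :
  linear (fun a : A => biadjoint (lact P a) x).
Proof. by move=> k a b; rewrite lact_linear biadjoint_linear. Qed.

Let biadj_lact_bound (x : dual (dual P)) (a : A) :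
  rnorm (biadjoint (lact P a) x) <= rnorm x * rnorm a.
Proof. by rewrite mulrC biadjoint_bound// opnorm_lact. Qed.

Let biadj_ract_linear (x : dual (dual P)) :
  linear (fun a : A => biadjoint (ract P a) x).
Proof. by move=> k a b; rewrite ract_linear biadjoint_linear. Qed.

Let biadj_ract_bound (x : dual (dual P)) (a : A) :
  rnorm (biadjoint (ract P a) x) <= rnorm x * rnorm a.
Proof. by rewrite mulrC biadjoint_bound// opnorm_ract. Qed.

(** Both sides are bounded and linear in each variable, so density applied first in [g], then in
    [f], reduces the identity to [virtual_diag_lact]. *)
Lemma sigma_lact f g : sigma (bamul f g) = biadjoint (lact P f) (sigma g).
Proof.
suff /(congr1 (fun F : blin A _ => F g)) :
  blin_comp sigma (lmul f) = blin_comp (biadjoint (lact P f)) sigma by [].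
apply: blin_dense => t.
suff /(congr1 (fun F : blin A _ => F f)) : blin_comp sigma (rmul (d t)) =
  mk_blin (biadj_lact_linear (sigma (d t))) (biadj_lact_bound (sigma (d t))) by [].
apply: blin_dense => s.
rewrite [LHS](_ : _ = sigma (bamul (d s) (d t)))// dd sigma_delta.
by rewrite virtual_diag_lact -sigma_delta.
Qed.

Lemma sigma_ract f g : sigma (bamul f g) = biadjoint (ract P g) (sigma f).
Proof.
suff /(congr1 (fun F : blin A _ => F f)) :
  blin_comp sigma (rmul g) = blin_comp (biadjoint (ract P g)) sigma by [].
apply: blin_dense => s.
suff /(congr1 (fun F : blin A _ => F g)) : blin_comp sigma (lmul (d s)) =
  mk_blin (biadj_ract_linear (sigma (d s))) (biadj_ract_bound (sigma (d s))) by [].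
apply: blin_dense => t.
rewrite [LHS](_ : _ = sigma (bamul (d s) (d t)))// dd sigma_delta.
by rewrite virtual_diag_ract -sigma_delta.
Qed.

Lemma sigma_prod f : biadjoint (prod_map P) (sigma f) = kappa A f.
Proof.
suff /(congr1 (fun F : blin A _ => F f)) :
  blin_comp (biadjoint (prod_map P)) sigma = kappa A by [].
apply: blin_dense => a.
rewrite [LHS](_ : _ = biadjoint (prod_map P) (sigma (d a)))//.
by rewrite sigma_delta virtual_diag_prod.
Qed.

Lemma biflat_with_of_amenable : biflat_with P.
Proof.
by exists sigma; split; [exact: sigma_lact|exact: sigma_ract|exact: sigma_prod].
Qed.

End BiflatIf.

Theorem theorem6p1 (R : realType) (G : semigroupType) :
  clifford_semigroup G ->
  (biflat (conv_alg R G) <->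
   (uniformly_locally_finite G /\
    forall x : idem G, amenable R (maxgroup x))).
Proof.
move=> HG; split=> [bf|[ulf am]].
  by split=> [|x]; [exact: biflat_ulf HG bf|exact: biflat_amenable].
exists ell1_proj_tensor; exact: biflat_with_of_amenable.
Qed.
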